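(* The IB unboundedness problem is decidable for FIFO machines: given a FIFO machine $M=(Q,\mathit{Ch},\Sigma,\Delta,q_0)$ and a tuple $(L_c)_{c\in\mathit{Ch}}$ of non-empty regular bounded languages $L_c\subseteq\Sigma_c^\ast$, it is decidable whether $\mathrm{Reach}_M(\mathrm{Pref}(L_!))$ is infinite.
   Context: A bounded language over non-empty words $(w_1,\ldots,w_n)$ is a language $L\subseteq w_1^\ast\cdots w_n^\ast$. A FIFO machine is $M=(Q,\mathit{Ch},\Sigma,\Delta,q_0)$ with finite control states $Q$, initial state $q_0$, finite channels $\mathit{Ch}$, alphabet $\Sigma=\biguplus_c\Sigma_c$, and $\Delta\subseteq Q\times A_M\times Q$, $A_M=\{c!a,c?a\mid c\in\mathit{Ch},a\in\Sigma_c\}$. Configurations $(q,\mathbf{w})$ with $\mathbf{w}\in\prod_c\Sigma_c^\ast$; initial $(q_0,(\varepsilon)_c)$. A send $c!a$ appends $a$ to channel $c$; a receive $c?a$ removes $a$ from the head of channel $c$ (only possible if $a$ is at the head); other channels unchanged; the control state moves along a transition of $\Delta$. $\mathrm{Reach}_M(L)$ is the set of configurations reachable from the initial one via a label word in $L\subseteq A_M^\ast$. $L_!=\{\sigma\in A_M^\ast\mid\mathrm{proj}_{c!}(\sigma)\in L_c\ \forall c\}$, where $\mathrm{proj}_{c!}$ keeps the messages of send actions on $c$ and erases all other actions. $\mathrm{Pref}(L)$ is the set of prefixes of words in $L$. *)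

(* Defs.v *)
From mathcomp Require Import all_boot.
Set Implicit Arguments. Unset Strict Implicit. Unset Printing Implicit Defensive.

(* 1. A Turing-complete model of computation: counter (Minsky)       *)
(*    machines with unboundedly many nat registers.                   *)
(*    "Decidable" = decided by some counter machine program.          *)

Inductive instr :=
  | INC of nat
  | DEC of nat & nat.

Definition cm_prog := seq instr.
Definition cm_state := (nat * (nat -> nat))%type.

Definition upd (f : nat -> nat) (r v : nat) : nat -> nat :=
  fun x => if x == r then v else f x.

Definition cm_step (P : cm_prog) (s : cm_state) : cm_state :=
  let: (pc, R) := s in
  if pc < size P then
    match nth (INC 0) P pc with
    | INC r => (pc.+1, upd R r (R r).+1)
    | DEC r j => if R r is k.+1 then (pc.+1, upd R r k) else (j, R)
    end
  else s.

Definition cm_computes (P : cm_prog) (x y : nat) : Prop :=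
  exists n, let s := iter n (cm_step P) (0, upd (fun _ => 0) 0 x) in
            size P <= s.1 /\ s.2 0 = y.

(* An action c!a (true) or c?a (false): (channel, is_send, message). *)
Definition act := (nat * bool * nat)%type.

(* FIFO machine: states 0..nstates-1, initial state q0, channels
   0..nch-1, channel c has alphabet Sigma_c = {0..alph_c - 1} (the
   disjoint union is realised by tagging actions with their channel). *)
Record fifo := Fifo {
  nstates : nat;
  q0 : nat;
  nch : nat;
  alph : seq nat;
  delta : seq (nat * act * nat)
}.

Record nfa := Nfa {
  nfa_n : nat;
  nfa_init : seq nat;
  nfa_fin : seq nat;
  nfa_tr : seq (nat * nat * nat)
}.

Definition nfa0 := Nfa 0 [::] [::] [::].

Definition fifo_wf (M : fifo) : Prop :=
  q0 M < nstates M /\ size (alph M) = nch M /\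
  all (fun t : nat * act * nat =>
         let: (q, (c, _, a), q') := t in
         [&& q < nstates M, q' < nstates M, c < nch M & a < nth 0 (alph M) c])
      (delta M).

Definition nfa_wf (A : nfa) (sigc : nat) : Prop :=
  all (fun p => p < nfa_n A) (nfa_init A) /\
  all (fun p => p < nfa_n A) (nfa_fin A) /\
  all (fun t : nat * nat * nat =>
         let: (p, a, p') := t in [&& p < nfa_n A, a < sigc & p' < nfa_n A])
      (nfa_tr A).

Definition instance_wf (M : fifo) (As : seq nfa) : Prop :=
  fifo_wf M /\ size As = nch M /\
  forall c, c < nch M -> nfa_wf (nth nfa0 As c) (nth 0 (alph M) c).

Inductive nfa_path (A : nfa) : nat -> seq nat -> nat -> Prop :=
  | np_nil p : nfa_path A p [::] p
  | np_cons p a p' w p'' :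
      (p, a, p') \in nfa_tr A -> nfa_path A p' w p'' -> nfa_path A p (a :: w) p''.

Definition nfa_accepts (A : nfa) (w : seq nat) : Prop :=
  exists p p', [/\ p \in nfa_init A, p' \in nfa_fin A & nfa_path A p w p'].

Definition in_bounded_expr (ws : seq (seq nat)) (w : seq nat) : Prop :=
  exists ks : seq nat, size ks = size ws /\
    w = flatten [seq flatten (nseq k.2 k.1) | k <- zip ws ks].

Definition bounded_lang (A : nfa) (sigc : nat) : Prop :=
  exists ws : seq (seq nat),
    all (fun u => (u != [::]) && all (fun a => a < sigc) u) ws /\
    forall w, nfa_accepts A w -> in_bounded_expr ws w.

Definition instance_promise (M : fifo) (As : seq nfa) : Prop :=
  forall c, c < nch M ->
    (exists w, nfa_accepts (nth nfa0 As c) w) /\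
    bounded_lang (nth nfa0 As c) (nth 0 (alph M) c).

Definition config := (nat * seq (seq nat))%type.

Definition init_config (M : fifo) : config := (q0 M, nseq (nch M) [::]).

Definition fifo_step (M : fifo) (cf : config) (x : act) (cf' : config) : Prop :=
  let: (q, w) := cf in
  let: (q', w') := cf' in
  let: (c, b, a) := x in
  [/\ (q, x, q') \in delta M, c < nch M &
      if b then w' = set_nth [::] w c (rcons (nth [::] w c) a)
      else exists u, nth [::] w c = a :: u /\ w' = set_nth [::] w c u].

Inductive fifo_run (M : fifo) : config -> seq act -> config -> Prop :=
  | run_nil cf : fifo_run M cf [::] cf
  | run_cons cf x cf' s cf'' :
      fifo_step M cf x cf' -> fifo_run M cf' s cf'' -> fifo_run M cf (x :: s) cf''.

Definition send_proj (c : nat) (s : seq act) : seq nat :=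
  [seq x.2 | x <- s & (x.1.1 == c) && x.1.2].

Definition in_L_bang (M : fifo) (As : seq nfa) (s : seq act) : Prop :=
  forall c, c < nch M -> nfa_accepts (nth nfa0 As c) (send_proj c s).

Definition in_Pref_L_bang (M : fifo) (As : seq nfa) (s : seq act) : Prop :=
  exists t, in_L_bang M As (s ++ t).

Definition Reach (M : fifo) (As : seq nfa) (cf : config) : Prop :=
  exists s, in_Pref_L_bang M As s /\ fifo_run M (init_config M) s cf.

Definition Reach_infinite (M : fifo) (As : seq nfa) : Prop :=
  ~ exists l : seq config, forall cf, Reach M As cf -> cf \in l.

Definition cpair (a b : nat) : nat := ((a + b) * (a + b).+1)./2 + b.

Fixpoint enc_seq (l : seq nat) : nat :=
  if l is x :: l' then (cpair x (enc_seq l')).+1 else 0.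

Definition enc_act (x : act) : nat :=
  let: (c, b, a) := x in cpair (cpair c (nat_of_bool b)) a.

Definition enc_ftr (t : nat * act * nat) : nat :=
  let: (q, x, q') := t in cpair (cpair q (enc_act x)) q'.

Definition enc_ntr (t : nat * nat * nat) : nat :=
  let: (p, a, p') := t in cpair (cpair p a) p'.

Definition enc_fifo (M : fifo) : nat :=
  enc_seq [:: nstates M; q0 M; nch M; enc_seq (alph M);
              enc_seq (map enc_ftr (delta M))].

Definition enc_nfa (A : nfa) : nat :=
  enc_seq [:: nfa_n A; enc_seq (nfa_init A); enc_seq (nfa_fin A);
              enc_seq (map enc_ntr (nfa_tr A))].

Definition enc_instance (M : fifo) (As : seq nfa) : nat :=
  cpair (enc_fifo M) (enc_seq (map enc_nfa As)).

(* Main.v *)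
Require Import Defs.
From mathcomp Require Import all_boot zify.
From Stdlib Require Import FunctionalExtensionality Classical ClassicalEpsilon.
Set Implicit Arguments. Unset Strict Implicit. Unset Printing Implicit Defensive.

(** A configuration is unfolded into a history recording, per channel, the word sent so
    far and the number of letters received. Its key (control state, channel contents,
    subset-construction states of the input automata on the words sent) determines the
    future, and there are infinitely many reachable configurations iff there are arbitrarily
    long runs without repeated key; absence of such runs of some length is thus a finite
    certificate of finiteness.

    Otherwise Koenig's lemma gives an infinite run with distinct keys. On a channel where
    letters are received forever, the infinite word sent has all its prefixes in those of
    [w_1^* ... w_n^*], hence is ultimately periodic, and from some point on the content is
    a factor of its periodic part. By Dickson's lemma two points of the run agree on
    control state, subset states and phases modulo the periods, with the contents no shorter
    at the later point; distinctness of keys makes one of them strictly longer.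
    Such a pair is a finite certificate of infinity, as the segment between the two points can
    be repeated forever: zero tests are no obstacle, so no appeal to reachability in vector
    addition systems is needed. The counter machine searches for either certificate. *)

(** * Compiling to counter machines *)

Inductive cmd :=
  | Skip
  | Inc of nat
  | If of nat & cmd
  | Loop of nat & cmd
  | Seq of cmd & cmd.

Definition regs := nat -> nat.

(** Register 1 is barred from commands, so it stays zero and [DEC 1 o] can serve as an unconditional
    jump. [If] and [Loop] decrement their register each time the body is entered. *)
Inductive exec : cmd -> regs -> regs -> Prop :=
  | ex_skip R : exec Skip R R
  | ex_inc r R : r != 1 -> exec (Inc r) R (upd R r (R r).+1)
  | ex_if0 r c R : r != 1 -> R r = 0 -> exec (If r c) R R
  | ex_if1 r c R k R' : r != 1 -> R r = k.+1 -> exec c (upd R r k) R' -> exec (If r c) R R'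
  | ex_loop0 r c R : r != 1 -> R r = 0 -> exec (Loop r c) R R
  | ex_loop1 r c R k R' R'' : r != 1 -> R r = k.+1 -> exec c (upd R r k) R' ->
      exec (Loop r c) R' R'' -> exec (Loop r c) R R''
  | ex_seq c d R R' R'' : exec c R R' -> exec d R' R'' -> exec (Seq c d) R R''.

(** Jump targets are absolute, hence the parameter [o], the address at which the code is placed. *)
Fixpoint compile (c : cmd) (o : nat) : cm_prog :=
  match c with
  | Skip => [::]
  | Inc r => [:: INC r]
  | If r c => let p := compile c o.+1 in DEC r (o.+1 + size p) :: p
  | Loop r c => let p := compile c o.+1 in
                DEC r (o.+2 + size p) :: p ++ [:: DEC 1 o]
  | Seq c d => let p := compile c o in p ++ compile d (o + size p)
  end.

Definition reaches (P : cm_prog) s s' := exists n, iter n (cm_step P) s = s'.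

Lemma reaches_trans P s1 s2 s3 : reaches P s1 s2 -> reaches P s2 s3 -> reaches P s1 s3.
Proof. by move=> [n <-] [m <-]; exists (m + n); rewrite iterD. Qed.

Lemma reaches_step P i pc R s : pc < size P -> nth (INC 0) P pc = i ->
  s = match i with
      | INC r => (pc.+1, upd R r (R r).+1)
      | DEC r j => if R r is k.+1 then (pc.+1, upd R r k) else (j, R)
      end -> reaches P (pc, R) s.
Proof. by move=> h hi ->; exists 1; rewrite /= h hi. Qed.

(** Induction on the derivation. The context [P1], [P2] is arbitrary so that the hypothesis on a
    subcommand applies inside a larger program; that register 1 is again zero is carried along
    because loops jump back through it. *)
Lemma compileP c R R' : exec c R R' -> R 1 = 0 -> R' 1 = 0 /\
  forall P1 P2, let p := compile c (size P1) in
    reaches (P1 ++ p ++ P2) (size P1, R) (size P1 + size p, R').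
Proof.
elim=> {c R R'} [R|r R r1|r c R r1 E|r c R k R' r1 E X IH|r c R r1 E
  |r c R k R' R'' r1 E X IH X' IH'|c d R R' R'' X IH X' IH'] R1.
- by split=> // P1 P2; exists 0; rewrite addn0.
- split; first by rewrite /upd eq_sym (negbTE r1).
  move=> P1 P2 p; apply: (reaches_step (i := INC r)).
  + by rewrite !size_cat /=; lia.
  + by rewrite nth_cat ltnn subnn.
  + by rewrite addn1.
- split=> // P1 P2 p; apply: (reaches_step (i := nth (INC 0) p 0)).
  + by rewrite !size_cat /=; lia.
  + by rewrite nth_cat ltnn subnn.
  + by rewrite /= E addSnnS.
- have /IH[R'1 {}IH] : upd R r k 1 = 0 by rewrite /upd eq_sym (negbTE r1).
  split=> // P1 P2 p; apply: reaches_trans.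
    apply: (reaches_step (i := nth (INC 0) p 0)).
    + by rewrite !size_cat /=; lia.
    + by rewrite nth_cat ltnn subnn.
    + by rewrite /= E; reflexivity.
  (* The leading [DEC] is absorbed into the left context of the body. *)
  have := IH (rcons P1 (nth (INC 0) p 0)) P2.
  by rewrite /= size_rcons -cats1 -catA /= addSnnS.
- split=> // P1 P2 p; apply: (reaches_step (i := nth (INC 0) p 0)).
  + by rewrite !size_cat /=; lia.
  + by rewrite nth_cat ltnn subnn.
  + by rewrite /= E /= size_cat /= addn1 !addSnnS.
- have /IH[R'1 {}IH] : upd R r k 1 = 0 by rewrite /upd eq_sym (negbTE r1).
  have [R''1 {}IH'] := IH' R'1.
  split=> // P1 P2 p; apply: reaches_trans; last exact: (IH' P1 P2).
  apply: reaches_trans.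
    apply: (reaches_step (i := nth (INC 0) p 0)).
    + by rewrite !size_cat /=; lia.
    + by rewrite nth_cat ltnn subnn.
    + by rewrite /= E; reflexivity.
  apply: reaches_trans.
    have := IH (rcons P1 (nth (INC 0) p 0)) (DEC 1 (size P1) :: P2).
    rewrite /= size_rcons -cats1 /p -!catA /=; exact.
  (* Register 1 is zero, so this jumps back to the head of the loop. *)
  apply: (reaches_step (i := DEC 1 (size P1))).
  + by rewrite /p /= !size_cat /= !size_cat /=; lia.
  + rewrite /p /= nth_cat ifN; last by lia.
    have -> : (size P1).+1 + size (compile c (size P1).+1) - size P1
      = (size (compile c (size P1).+1)).+1 by lia.
    by rewrite /= -catA nth_cat ltnn subnn.
  + by rewrite R'1.
- have [R'1 {}IH] := IH R1.
  have [R''1 {}IH'] := IH' R'1.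
  split=> // P1 P2 p; apply: reaches_trans.
    rewrite /p /= -catA; exact: IH.
  have := IH' (P1 ++ compile c (size P1)) P2.
  by rewrite /p /= !size_cat -!catA addnA.
Qed.

Lemma compile_computes c x y R' :
  exec c (upd (fun _ => 0) 0 x) R' -> R' 0 = y -> cm_computes (compile c 0) x y.
Proof.
move=> X <-; have [//|_ /(_ [::] [::]) /=] := compileP X.
rewrite cats0 add0n => -[n E]; exists n; rewrite E /=; split=> //.
Qed.

Ltac regext := let j := fresh "j" in
  apply: functional_extensionality => j; rewrite /upd; 
  repeat (case: eqP => ?; [try subst|]); try lia.

Lemma exec_eq c R R1 R2 : exec c R R1 -> R1 = R2 -> exec c R R2.
Proof. by move=> X <-. Qed.

Lemma exec_move r s R : r != 1 -> s != 1 -> r != s ->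
  exec (Loop r (Inc s)) R (upd (upd R r 0) s (R s + R r)).
Proof.
move=> r1 s1 rs; move E: (R r) => n; elim: n R E => [|n IH] R E.
  apply: exec_eq; first exact: ex_loop0. regext.
apply: exec_eq.
  apply: (ex_loop1 r1 E); first exact: ex_inc.
  by apply: IH; rewrite /upd (negbTE rs) eqxx.
regext.
Qed.

Lemma exec_move2 r s t R : r != 1 -> s != 1 -> t != 1 -> r != s -> r != t -> s != t ->
  exec (Loop r (Seq (Inc s) (Inc t))) R
       (upd (upd (upd R r 0) s (R s + R r)) t (R t + R r)).
Proof.
move=> r1 s1 t1 rs rt st; move E: (R r) => n; elim: n R E => [|n IH] R E.
  apply: exec_eq; first exact: ex_loop0. regext.
apply: exec_eq.
  apply: (ex_loop1 r1 E); first by apply: ex_seq; exact: ex_inc.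
  by apply: IH; rewrite /upd (negbTE rs) (negbTE rt) eqxx.
regext.
Qed.

Lemma exec_clear r R : r != 1 -> exec (Loop r Skip) R (upd R r 0).
Proof.
move=> r1; move E: (R r) => n; elim: n R E => [|n IH] R E.
  apply: exec_eq; first exact: ex_loop0. regext.
apply: exec_eq.
  apply: (ex_loop1 r1 E); first exact: ex_skip.
  by apply: IH; rewrite /upd eqxx.
regext.
Qed.

(* [s += r] through the scratch register [t]. *)
Definition Copy r s t := Seq (Loop r (Seq (Inc s) (Inc t))) (Loop t (Inc r)).

Lemma exec_copy r s t R : r != 1 -> s != 1 -> t != 1 -> r != s -> r != t -> s != t ->
  R t = 0 -> exec (Copy r s t) R (upd R s (R s + R r)).
Proof.
move=> r1 s1 t1 rs rt st t0; apply: exec_eq.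
  apply: ex_seq; first exact: exec_move2.
  by apply: exec_move => //; rewrite eq_sym.
regext.
Qed.

(** * Pairing and unpairing on registers *)

Definition ustep (p : nat * nat) : nat * nat :=
  if p.1 is a.+1 then (a, p.2.+1) else (p.2.+1, 0).
(** [cpair] numbers the points of the plane antidiagonal by antidiagonal, and [ustep] moves to the
    next point of this walk; so [n] steps from the origin invert the pairing. *)
Definition unpair n := iter n ustep (0, 0).

Lemma tri_half n : (n * n.+1)./2 + n.+1 = (n.+1 * n.+2)./2.
Proof.
have -> : n.+1 * n.+2 = n * n.+1 + n.+1.*2 by lia.
by rewrite halfD odd_double andbF doubleK.
Qed.

Lemma unpairS n : unpair n.+1 = ustep (unpair n). Proof. by []. Qed.

Lemma cpairSr a b : cpair a b.+1 = (cpair a.+1 b).+1.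
Proof. by rewrite /cpair addSnnS addnS. Qed.

Lemma cpairS0 a : cpair a.+1 0 = (cpair 0 a).+1.
Proof. by rewrite /cpair !addn0 add0n -tri_half; lia. Qed.

Lemma unpairK a b : unpair (cpair a b) = (a, b).
Proof.
(* Induction on the antidiagonal, then on the position along it. *)
suff H s : forall a b, a + b = s -> unpair (cpair a b) = (a, b) by exact: (H (a + b)).
elim: s => [|s IHs] {}a {}b; first by move/eqP; rewrite addn_eq0 => /andP[/eqP-> /eqP->].
elim: b a => [|b IHb] a E.
  case: a E => // a; rewrite addn0 => -[E].
  by rewrite cpairS0 unpairS IHs.
rewrite cpairSr unpairS IHb //; lia.
Qed.

Definition c1 n := (unpair n).1.
Definition c2 n := (unpair n).2.
Lemma c1K a b : c1 (cpair a b) = a. Proof. by rewrite /c1 unpairK. Qed.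
Lemma c2K a b : c2 (cpair a b) = b. Proof. by rewrite /c2 unpairK. Qed.

(* [cmp f]: at every base register [k] some command replaces the content [x] of [k]
   by [f x], provided the registers above [k] are zero, and restores them. *)
Definition impl k c (f : nat -> nat) := forall R,
  (forall j, k < j -> R j = 0) -> exec c R (upd R k (f (R k))).
Definition cmp f := forall k, 1 < k -> exists c, impl k c f.

Lemma cmp_ext f g : cmp f -> f =1 g -> cmp g.
Proof. by move=> H /functional_extensionality <-. Qed.

Lemma cmp_id : cmp id.
Proof. move=> k k1; exists Skip => R _; apply: exec_eq; first exact: ex_skip. regext. Qed.

Lemma cmp_zero : cmp (fun=> 0).
Proof. by move=> k k1; exists (Loop k Skip) => R _; apply: exec_clear; lia. Qed.

Lemma cmp_succ : cmp succn.
Proof. by move=> k k1; exists (Inc k) => R _; apply: ex_inc; lia. Qed.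

Lemma cmp_pred : cmp predn.
Proof.
move=> k k1; exists (If k Skip) => R _; case E: (R k) => [|n].
  by apply: exec_eq; [apply: ex_if0; [lia|] | regext].
by apply: exec_eq; [apply: (ex_if1 _ E); [lia|exact: ex_skip] | regext].
Qed.

Lemma cmp_comp f g : cmp f -> cmp g -> cmp (fun x => f (g x)).
Proof.
move=> F G k k1; have [c C] := F k k1; have [d D] := G k k1.
exists (Seq d c) => R z; apply: exec_eq.
  apply: ex_seq; first exact: D. apply: C => j kj; rewrite /upd ifN ?z //; lia.
regext.
Qed.

(** The flag [f] simulates an else branch: it is raised first, lowered if [a] was positive, and the
    last [If] runs only when it is still up. *)
Definition Ustep a b f :=
  Seq (Inc f) (Seq (If a (Seq (If f Skip) (Inc b)))
                   (If f (Seq (Loop b (Inc a)) (Inc a)))).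

Lemma exec_ustep a b f R : 1 < a -> 1 < b -> 1 < f -> a != b -> a != f -> b != f -> R f = 0 ->
  exec (Ustep a b f) R (upd (upd R a (ustep (R a, R b)).1) b (ustep (R a, R b)).2).
Proof.
move=> a1 b1 f1 ab af bf f0; case E: (R a) => [|n] /=; apply: exec_eq.
- apply: ex_seq; first by apply: ex_inc; lia.
  apply: ex_seq; first by apply: ex_if0; [lia|rewrite /upd (negbTE af)].
  apply: (ex_if1 (k := 0)); [lia|by rewrite /upd eqxx f0|].
  apply: ex_seq; first by apply: exec_move; lia.
  by apply: ex_inc; lia.
- regext.
- apply: ex_seq; first by apply: ex_inc; lia.
  apply: ex_seq; first (apply: (ex_if1 (k := n)); [lia|by rewrite /upd (negbTE af)|]).
    apply: ex_seq; first (apply: (ex_if1 (k := 0)); [lia| |exact: ex_skip]).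
      by rewrite /upd eq_sym (negbTE af) eqxx f0.
    by apply: ex_inc; lia.
  by apply: ex_if0; [lia|rewrite /upd; repeat case: eqP; lia].
- regext.
Qed.

Definition Unpair k := Loop k (Ustep k.+1 k.+2 k.+3).

Lemma exec_unpair k R : 1 < k -> (forall j, k < j -> R j = 0) ->
  exec (Unpair k) R (upd (upd (upd R k 0) k.+1 (c1 (R k))) k.+2 (c2 (R k))).
Proof.
move=> k1 z.
(* [m] counts the steps of the walk already made. *)
suff H n : forall m R, R k = n -> R k.+1 = (unpair m).1 -> R k.+2 = (unpair m).2 ->
    R k.+3 = 0 -> exec (Unpair k) R
      (upd (upd (upd R k 0) k.+1 (unpair (n + m)).1) k.+2 (unpair (n + m)).2).
  by have := H (R k) 0 R; rewrite addn0; apply=> //; apply: z; lia.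
elim: n => [|n IH] m {z}R Rk Ra Rb Rf.
  by apply: exec_eq; [apply: ex_loop0; lia | rewrite add0n -Ra -Rb; regext].
apply: exec_eq.
  apply: (ex_loop1 _ Rk); first lia.
    by apply: exec_ustep; try lia; rewrite /upd; case: eqP; lia.
  have E : ustep (upd R k n k.+1, upd R k n k.+2) = unpair m.+1.
    rewrite unpairS [unpair m]surjective_pairing -Ra -Rb /upd.
    by do 2 (case: eqP; first lia).
  by apply: (IH m.+1); rewrite E /upd; repeat case: eqP; lia.
by rewrite addnS addSn; regext.
Qed.

Lemma cmp_fst : cmp c1.
Proof.
move=> k k1; exists (Seq (Unpair k) (Seq (Loop k.+2 Skip) (Loop k.+1 (Inc k)))) => R z.
apply: exec_eq.
  apply: ex_seq; first exact: exec_unpair.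
  by apply: ex_seq; [apply: exec_clear|apply: exec_move]; lia.
have z1 := z k.+1; have z2 := z k.+2; regext.
Qed.

Lemma cmp_snd : cmp c2.
Proof.
move=> k k1; exists (Seq (Unpair k) (Seq (Loop k.+1 Skip) (Loop k.+2 (Inc k)))) => R z.
apply: exec_eq.
  apply: ex_seq; first exact: exec_unpair.
  by apply: ex_seq; [apply: exec_clear|apply: exec_move]; lia.
have z1 := z k.+1; have z2 := z k.+2; regext.
Qed.

(* [cpair a b = b + (1 + ... + (a + b))]. *)
Definition Pair k a b t :=
  Seq (Loop b (Seq (Inc k) (Inc a)))
      (Loop a (Seq (Inc k) (Copy a k t))).

Lemma exec_tri k a t R : 1 < k -> 1 < a -> 1 < t -> k != a -> k != t -> a != t -> R t = 0 ->
  exec (Loop a (Seq (Inc k) (Copy a k t))) R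
       (upd (upd R a 0) k (R k + (R a * (R a).+1)./2)).
Proof.
move=> k1 a1 t1 ka kt at_; move E: (R a) => n; elim: n R E => [|n IH] R E t0.
  by apply: exec_eq; [apply: ex_loop0; lia | regext].
apply: exec_eq.
  apply: (ex_loop1 _ E); first lia.
    apply: ex_seq; first by apply: ex_inc; lia.
    by apply: exec_copy; try lia; rewrite /upd; repeat case: eqP; lia.
  by apply: IH; rewrite /upd; repeat case: eqP; lia.
rewrite -tri_half; regext.
Qed.

Lemma exec_pair k a b t R : 1 < k -> 1 < a -> 1 < b -> 1 < t -> uniq [:: k; a; b; t] ->
  R k = 0 -> R t = 0 ->
  exec (Pair k a b t) R (upd (upd (upd R k (cpair (R a) (R b))) a 0) b 0).
Proof.
rewrite /= !inE !negb_or andbT => k1 a1 b1 t1 /and3P[/and3P[ka kb kt] /andP[ab at_] bt] k0 t0.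
apply: exec_eq.
  apply: ex_seq; first by apply: exec_move2; lia.
  apply: exec_tri; try lia.
  by rewrite /upd; repeat case: eqP; lia.
rewrite /cpair; apply: functional_extensionality => j; rewrite /upd.
repeat (case: eqP => ?; try subst; try lia); rewrite ?k0 ?add0n //.
Qed.

(** The argument stays in [k] while [f] is computed at [k.+1] and then [g] at [k.+2], so that each
    finds only zero registers above it. *)
Lemma cmp_pair f g : cmp f -> cmp g -> cmp (fun x => cpair (f x) (g x)).
Proof.
move=> F G k k1; have [|c C] := F k.+1; first lia.
have [|d D] := G k.+2; first lia.
exists (Seq (Copy k k.+1 k.+2) (Seq c (Seq (Copy k k.+2 k.+3)
  (Seq d (Seq (Loop k Skip) (Pair k k.+1 k.+2 k.+3)))))) => R z.
have z1 := z k.+1; have z2 := z k.+2; have z3 := z k.+3.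
apply: exec_eq.
  apply: ex_seq; first by apply: exec_copy; lia.
  apply: ex_seq; first by apply: C => j kj; rewrite /upd;
    repeat case: eqP; try lia; move=> *; apply: z; lia.
  apply: ex_seq; first by apply: exec_copy; try lia; rewrite /upd; repeat case: eqP; lia.
  apply: ex_seq; first by apply: D => j kj; rewrite /upd;
    repeat case: eqP; try lia; move=> *; apply: z; lia.
  apply: ex_seq; first by apply: exec_clear; lia.
  apply: exec_pair; try lia; first by rewrite /= !inE; lia.
  all: rewrite /upd; repeat (case: eqP => ?; try subst; try lia).
apply: functional_extensionality => j; rewrite /upd.
repeat (case: eqP => ?; try subst; try lia).
rewrite !z1 // !z2 // ?add0n.
Qed.

Lemma exec_iter a k c f R : 1 < a -> a < k -> impl k c f -> (forall j, k < j -> R j = 0) ->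
  exec (Loop a c) R (upd (upd R a 0) k (iter (R a) f (R k))).
Proof.
move=> a1 ak C; move E: (R a) => n; elim: n R E => [|n IH] R E z.
  by apply: exec_eq; [apply: ex_loop0; lia | regext].
apply: exec_eq.
  apply: (ex_loop1 _ E); first lia.
    by apply: C => j kj; rewrite /upd; case: eqP; [lia|move=> _; exact: z].
  apply: IH; first by rewrite /upd; repeat case: eqP; lia.
  by move=> j kj; rewrite /upd; repeat case: eqP; try lia; move=> *; apply: z.
rewrite iterSr.
have -> : upd R a n k = R k by rewrite /upd; case: eqP; lia.
have -> : upd (upd R a n) k (f (R k)) k = f (R k) by rewrite /upd eqxx.
regext.
Qed.

(** Bounded iteration, with counter in [k.+1] and state in [k.+2]; together with pairing it supplies
    primitive recursion. *)
Lemma cmp_iter f : cmp f -> cmp (fun x => iter (c1 x) f (c2 x)).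
Proof.
move=> F k k1; have [|c C] := F k.+2; first lia.
exists (Seq (Unpair k) (Seq (Loop k.+1 c) (Loop k.+2 (Inc k)))) => R z.
have z1 := z k.+1; have z2 := z k.+2; have z3 := z k.+3.
apply: exec_eq.
  apply: ex_seq; first exact: exec_unpair.
  apply: ex_seq.
    apply: (exec_iter (k := k.+2)); [lia|lia|exact: C|].
    by move=> j kj; rewrite /upd; repeat case: eqP; try lia; move=> *; apply: z; lia.
  by apply: exec_move; lia.
apply: functional_extensionality => j; rewrite /upd.
repeat (case: eqP => ?; try subst; try lia).
Qed.

(* Unbounded search: [0] means "try the next number", [v.+1] means "answer [v]". *)
Lemma cmp_search (r : nat -> nat) : cmp r ->
  exists P, forall x n v, (forall m, m < n -> r (cpair x m) = 0) ->
    r (cpair x n) = v.+1 -> cm_computes P x v.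
Proof.
move=> r_cmp.
have [//|ci Ci] := cmp_pair cmp_id cmp_zero (k := 3).
have [//|cn Cn] := cmp_pair cmp_fst (cmp_comp cmp_succ cmp_snd) (k := 3).
have [//|cr Cr] := r_cmp 4.
(* Register 2 tells whether to go on, 3 holds the pair of input and current trial, 4 receives the
   value of [r], 5 is scratch. A value [v.+1] lowers register 2 and leaves [v] in register 0. *)
pose body := Seq (Copy 3 4 5) (Seq cr (Seq (Inc 2)
               (Seq (If 4 (Seq (If 2 Skip) (Loop 4 (Inc 0)))) cn))).
exists (compile (Seq (Loop 0 (Inc 3)) (Seq ci (Seq (Inc 2) (Loop 2 body)))) 0).
move=> x n v lo hi.
suff [R' [X R'0]] : exists R', exec (Loop 2 body)
    (fun j => if j == 2 then 1 else if j == 3 then cpair x 0 else 0) R' /\ R' 0 = v.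
  apply: compile_computes R'0.
  apply: ex_seq; first by apply: exec_move.
  apply: ex_seq; first by apply: Ci => -[|[|[|[|j]]]].
  apply: ex_seq; first exact: ex_inc.
  by move: X; congr exec; apply: functional_extensionality => -[|[|[|[|j]]]].
(* [k] is the number of failing trials still ahead. *)
suff H k : k <= n -> exists R', exec (Loop 2 body)
    (fun j => if j == 2 then 1 else if j == 3 then cpair x (n - k) else 0) R' /\ R' 0 = v.
  by have := H n (leqnn n); rewrite subnn.
elim: k => [|k IH] kn.
  eexists; split.
    apply: (ex_loop1 (k := 0)) => //.
      apply: ex_seq; first exact: exec_copy.
      apply: ex_seq; first by apply: Cr => -[|[|[|[|[|j]]]]].
      apply: ex_seq; first exact: ex_inc.
      apply: ex_seq.
        apply: (ex_if1 (k := v)) => //; first by rewrite /upd /= add0n subn0 hi.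
        apply: ex_seq; first by apply: (ex_if1 (k := 0)) => //; exact: ex_skip.
        exact: exec_move.
      by apply: Cn => -[|[|[|[|[|j]]]]].
    exact: ex_loop0.
  by [].
have [R' [X R'0]] := IH (ltnW kn).
exists R'; split=> //.
apply: (ex_loop1 (k := 0)) => //; last exact: X.
apply: exec_eq.
  apply: ex_seq; first exact: exec_copy.
  apply: ex_seq; first by apply: Cr => -[|[|[|[|[|j]]]]].
  apply: ex_seq; first exact: ex_inc.
  apply: ex_seq.
    apply: ex_if0 => //; rewrite /upd /= add0n lo //; lia.
  by apply: Cn => -[|[|[|[|[|j]]]]] // _; rewrite /upd /= add0n lo //; lia.
apply: functional_extensionality => -[|[|[|[|[|j]]]]] //=; rewrite /upd /=.
  by rewrite c1K c2K; congr cpair; lia.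
by rewrite add0n lo //; lia.
Qed.

(** * Typed computable functions *)

(** The instances follow the encodings of the theorem, so that [cod (M, As)] is [enc_instance M As]
    by computation. *)
Class code (T : Type) := cod : T -> nat.
#[local] Instance code_nat : code nat := id.
#[local] Instance code_bool : code bool := nat_of_bool.
#[local] Instance code_pair A B {_ : code A} {_ : code B} : code (A * B) :=
  fun p => cpair (cod p.1) (cod p.2).
#[local] Instance code_seq A {_ : code A} : code (seq A) := fun l => enc_seq (map cod l).
#[local] Instance code_fifo : code fifo := enc_fifo.
#[local] Instance code_nfa : code nfa := enc_nfa.

(** Nothing is asked of [g] outside the codes. The closure properties below rest on bounded
    iteration only. *)
Definition PR A B {_ : code A} {_ : code B} (f : A -> B) :=
  exists2 g, cmp g & forall a, g (cod a) = cod (f a).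

Lemma cmp_const n : cmp (fun=> n).
Proof. by elim: n => [|n IH]; [exact: cmp_zero | exact: (cmp_comp cmp_succ IH)]. Qed.

(** Iterate [b n] times, from the pair of both branches, the map that overwrites the first component
    by the second; then take the first component. *)
Lemma cmp_if0 b f g : cmp b -> cmp f -> cmp g -> cmp (fun n => if b n is 0 then f n else g n).
Proof.
move=> B F G.
have S := cmp_iter (cmp_pair cmp_snd cmp_snd).
apply: cmp_ext (cmp_comp cmp_fst (cmp_comp S (cmp_pair B (cmp_pair F G)))) _ => n.
rewrite c1K c2K; case: (b n) => [|m]; first by rewrite /= c1K.
suff -> : iter m.+1 (fun x => cpair (c2 x) (c2 x)) (cpair (f n) (g n)) = cpair (g n) (g n)
  by rewrite c1K.
by elim: m => [|m /= ->]; rewrite /= c2K.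
Qed.

Lemma PR_ext A B {ca : code A} {cb : code B} (f f' : A -> B) : PR f -> f =1 f' -> PR f'.
Proof. by move=> H /functional_extensionality <-. Qed.

Lemma PR_id A {ca : code A} : PR (fun x : A => x).
Proof. by exists id; first exact: cmp_id. Qed.

Lemma PR_const X A {cx : code X} {ca : code A} (a : A) : PR (fun _ : X => a).
Proof. by exists (fun=> cod a); first exact: cmp_const. Qed.

Section Combinators.
Context {X A B : Type} {cx : code X} {ca : code A} {cb : code B}.

Lemma PR_comp (f : A -> B) (g : X -> A) : PR f -> PR g -> PR (fun x => f (g x)).
Proof.
move=> [f' F Ff] [g' G Gg]; exists (fun n => f' (g' n)); first exact: cmp_comp.
by move=> a; rewrite Gg Ff.
Qed.

Lemma PR_pair (f : X -> A) (g : X -> B) : PR f -> PR g -> PR (fun x => (f x, g x)).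
Proof.
move=> [f' F Ff] [g' G Gg]; exists (fun n => cpair (f' n) (g' n)); first exact: cmp_pair.
by move=> a; rewrite Gg Ff.
Qed.

Lemma PR_fst (g : X -> A * B) : PR g -> PR (fun x => (g x).1).
Proof.
move=> [g' G Gg]; exists (fun n => c1 (g' n)); first exact: cmp_comp cmp_fst G.
by move=> a; rewrite Gg c1K.
Qed.

Lemma PR_snd (g : X -> A * B) : PR g -> PR (fun x => (g x).2).
Proof.
move=> [g' G Gg]; exists (fun n => c2 (g' n)); first exact: cmp_comp cmp_snd G.
by move=> a; rewrite Gg c2K.
Qed.

Lemma PR_cons (f : X -> A) (g : X -> seq A) : PR f -> PR g -> PR (fun x => f x :: g x).
Proof.
move=> [f' F Ff] [g' G Gg]; exists (fun n => (cpair (f' n) (g' n)).+1).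
  exact: cmp_comp cmp_succ (cmp_pair F G).
by move=> a; rewrite Gg Ff.
Qed.

Lemma PR_behead (g : X -> seq A) : PR g -> PR (fun x => behead (g x)).
Proof.
move=> [g' G Gg]; exists (fun n => c2 (g' n).-1).
  exact: cmp_comp cmp_snd (cmp_comp cmp_pred G).
by move=> a; rewrite Gg; case: (g a) => [|b l] //; rewrite /= c2K.
Qed.

Lemma PR_head (d : X -> A) (g : X -> seq A) : PR d -> PR g -> PR (fun x => head (d x) (g x)).
Proof.
move=> [d' D' Dd] [g' G Gg]; exists (fun n => if g' n is 0 then d' n else c1 (g' n).-1).
  exact: cmp_if0 G D' (cmp_comp cmp_fst (cmp_comp cmp_pred G)).
by move=> a; rewrite Gg Dd; case: (g a) => [|b l] //=; rewrite c1K.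
Qed.

Lemma PR_if (b : X -> bool) (f g : X -> A) : PR b -> PR f -> PR g ->
  PR (fun x => if b x then f x else g x).
Proof.
move=> [b' B' Bb] [f' F Ff] [g' G Gg].
exists (fun n => if b' n is 0 then g' n else f' n); first exact: cmp_if0.
by move=> a; rewrite Bb Gg Ff; case: (b a).
Qed.

(** Since [cmp_iter] iterates a function without parameter, [x] travels inside the state. *)
Lemma PR_iter (n : X -> nat) (f : X -> A -> A) (a : X -> A) :
  PR n -> PR (fun p => f p.1 p.2) -> PR a -> PR (fun x => iter (n x) (f x) (a x)).
Proof.
move=> [n' N Nn] [f' F Ff] [a' A' Aa].
exists (fun x => c2 (iter (n' x) (fun s => cpair (c1 s) (f' s)) (cpair x (a' x)))).
  have S := cmp_iter (cmp_pair cmp_fst F).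
  apply: cmp_ext (cmp_comp cmp_snd (cmp_comp S (cmp_pair N (cmp_pair cmp_id A')))) _ => x.
  by rewrite c1K c2K.
move=> x; rewrite Nn Aa.
have H m : iter m (fun s => cpair (c1 s) (f' s)) (cpair (cod x) (cod (a x))) =
          cpair (cod x) (cod (iter m (f x) (a x))).
  by elim: m => //= m ->; rewrite c1K (Ff (x, _)).
by rewrite H c2K.
Qed.

Lemma PR_foldl (f : X -> A -> B -> A) (a : X -> A) (l : X -> seq B) :
  PR (fun p => f p.1.1 p.1.2 p.2) -> PR a -> PR l ->
  PR (fun x => foldl (f x) (a x) (l x)).
Proof.
move=> [f' F Ff] [a' A' Aa] [l' L Ll].
(* The state packs the parameter, the accumulator and the remaining list, and is stationary once
   that list is empty. Any number of iterations at least the length is then correct; the code of the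
   list is one. *)
pose st s := if c2 (c2 s) is 0 then s else
  cpair (c1 s) (cpair (f' (cpair (cpair (c1 s) (c1 (c2 s))) (c1 (c2 (c2 s)).-1)))
                      (c2 (c2 (c2 s)).-1)).
have S : cmp st.
  have c22 := cmp_comp cmp_snd cmp_snd.
  have p22 := cmp_comp cmp_pred c22.
  apply: cmp_if0 c22 cmp_id (cmp_pair cmp_fst (cmp_pair (cmp_comp F _) (cmp_comp cmp_snd p22))).
  apply: cmp_pair (cmp_comp cmp_fst p22).
  exact: cmp_pair cmp_fst (cmp_comp cmp_fst cmp_snd).
exists (fun n => c1 (c2 (iter (l' n) st (cpair n (cpair (a' n) (l' n)))))).
  have := cmp_comp (cmp_iter S) (cmp_pair L (cmp_pair cmp_id (cmp_pair A' L))).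
  move=> /(cmp_comp cmp_snd)/(cmp_comp cmp_fst) /cmp_ext; apply=> n.
  by rewrite c1K c2K.
move=> x; rewrite Ll Aa.
have sz : size (l x) <= cod (l x).
  elim: (l x) => // b s IH /=; apply: leq_ltn_trans IH _.
  by rewrite ltnS; exact: leq_addl.
have H m s : forall a0, size s <= m ->
    c1 (c2 (iter m st (cpair (cod x) (cpair (cod a0) (cod s))))) = cod (foldl (f x) a0 s).
  elim: m s => [|m IH] s a0 E; first by case: s E => //= _; rewrite c2K c1K.
  rewrite iterSr; case: s E => [|b s] E.
    have -> : st (cpair (cod x) (cpair (cod a0) (cod ([::] : seq B)))) =
      cpair (cod x) (cpair (cod a0) (cod ([::] : seq B))) by rewrite /st !c2K.
    by rewrite IH.
  have -> : st (cpair (cod x) (cpair (cod a0) (cod (b :: s)))) =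
      cpair (cod x) (cpair (cod (f x a0 b)) (cod s)).
    change (cod (b :: s)) with (cpair (cod b) (cod s)).+1.
    rewrite /st !c2K !c1K /= ?c2K ?c1K. by congr cpair; congr cpair; exact: (Ff (x, a0, b)).
  exact: IH.
exact: H.
Qed.

Lemma PR_succ (f : X -> nat) : PR f -> PR (fun x => (f x).+1).
Proof.
move=> [f' F Ff]; exists (fun n => (f' n).+1); first exact: cmp_comp cmp_succ F.
by move=> x; rewrite Ff.
Qed.

Lemma PR_pred (f : X -> nat) : PR f -> PR (fun x => (f x).-1).
Proof.
move=> [f' F Ff]; exists (fun n => (f' n).-1); first exact: cmp_comp cmp_pred F.
by move=> x; rewrite Ff.
Qed.

Lemma PR_is0 (f : X -> nat) : PR f -> PR (fun x => f x == 0).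
Proof.
move=> [f' F Ff]; exists (fun n => if f' n is 0 then 1 else 0).
  exact: cmp_if0 F (cmp_const 1) (cmp_const 0).
by move=> x; rewrite Ff; case: (f x).
Qed.

End Combinators.

(** Peels off one syntactic layer, recovering the subterms as functions of [x] by higher-order
    patterns. *)
Ltac prb := cbv beta; lazymatch goal with
  | |- PR (fun x => x) => exact: PR_id
  | |- PR (fun _ => ?a) => exact: PR_const
  | |- PR (fun x => (@?f x, @?g x)) => refine (PR_pair (f := f) (g := g) _ _)
  | |- PR (fun x => (@?g x).1) => refine (PR_fst (g := g) _)
  | |- PR (fun x => (@?g x).2) => refine (PR_snd (g := g) _)
  | |- PR (fun x => @?f x :: @?g x) => refine (PR_cons (f := f) (g := g) _ _)
  | |- PR (fun x => S (@?f x)) => refine (PR_succ (f := f) _)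
  | |- PR (fun x => Nat.pred (@?f x)) => refine (PR_pred (f := f) _)
  | |- PR (fun x => if _ then _ else _) => apply: PR_if
  | |- PR (fun x => ?f (@?g x)) =>
      first [assumption | refine (PR_comp (f := f) (g := g) _ _)]
  | |- PR (@fst _ _) => exact: (PR_fst PR_id)
  | |- PR (@snd _ _) => exact: (PR_snd PR_id)
  | |- PR _ => assumption
  end.

Generalizable All Variables.

Lemma PR_add `{code X} (f g : X -> nat) : PR f -> PR g -> PR (fun x => f x + g x).
Proof.
move=> F G; apply: PR_ext (_ : PR (fun x => iter (f x) succn (g x))) _.
  by apply: PR_iter; repeat prb.
by move=> x; rewrite iter_succn addnC.
Qed.

Lemma PR_sub `{code X} (f g : X -> nat) : PR f -> PR g -> PR (fun x => f x - g x).
Proof.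
move=> F G; apply: PR_ext (_ : PR (fun x => iter (g x) predn (f x))) _.
  by apply: PR_iter; repeat prb.
by move=> x; rewrite iter_predn.
Qed.

Lemma PR_mul `{code X} (f g : X -> nat) : PR f -> PR g -> PR (fun x => f x * g x).
Proof.
move=> F G; apply: PR_ext (_ : PR (fun x => iter (f x) (addn (g x)) 0)) _.
  apply: (PR_iter (f := fun x => addn (g x))); repeat prb.
by cbv beta; apply: PR_add; repeat prb.
by move=> x; rewrite iter_addn addn0 mulnC.
Qed.

Lemma PR_leq `{code X} (f g : X -> nat) : PR f -> PR g -> PR (fun x => f x <= g x).
Proof. by move=> F G; apply: PR_is0; apply: PR_sub. Qed.

Lemma PR_and `{code X} (f g : X -> bool) : PR f -> PR g -> PR (fun x => f x && g x).
Proof. by move=> F G; rewrite /andb; repeat prb. Qed.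

Lemma PR_or `{code X} (f g : X -> bool) : PR f -> PR g -> PR (fun x => f x || g x).
Proof. by move=> F G; rewrite /orb; repeat prb. Qed.

Lemma PR_neg `{code X} (f : X -> bool) : PR f -> PR (fun x => ~~ f x).
Proof. by move=> F; rewrite /negb; repeat prb. Qed.

Lemma PR_eqn `{code X} (f g : X -> nat) : PR f -> PR g -> PR (fun x => f x == g x).
Proof.
move=> F G; apply: PR_ext (_ : PR (fun x => (f x <= g x) && (g x <= f x))) _.
  by apply: PR_and; apply: PR_leq.
by move=> x; rewrite eqn_leq.
Qed.

Lemma PR_rev `{code X, code A} (l : X -> seq A) : PR l -> PR (fun x => rev (l x)).
Proof.
move=> L; apply: PR_ext (_ : PR (fun x => foldl (fun s y => y :: s) [::] (l x))) _.
  by apply: PR_foldl; repeat prb.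
by move=> x; rewrite -[l x in LHS]revK foldl_rev; elim: (rev _) => //= a s ->.
Qed.

Lemma PR_foldr `{code X, code A, code B} (f : X -> B -> A -> A) (a : X -> A) (l : X -> seq B) :
  PR (fun p => f p.1.1 p.1.2 p.2) -> PR a -> PR l ->
  PR (fun x => foldr (f x) (a x) (l x)).
Proof.
move=> F P L; apply: PR_ext (_ : PR (fun x => foldl (fun a b => f x b a) (a x) (rev (l x)))) _.
  apply: (PR_foldl (f := fun x a b => f x b a)) => //; last exact: PR_rev.
  by apply: (PR_comp (f := fun p => f p.1.1 p.1.2 p.2) (g := fun p => (p.1.1, p.2, p.1.2))) => //;
    repeat prb.
by move=> x; rewrite foldl_rev.
Qed.

Lemma PR_map `{code X, code A, code B} (f : X -> A -> B) (l : X -> seq A) :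
  PR (fun p => f p.1 p.2) -> PR l ->
  PR (fun x => [seq f x y | y <- l x]).
Proof.
move=> F L; apply: PR_ext (_ : PR (fun x => foldr (fun y s => f x y :: s) [::] (l x))) _.
  apply: (PR_foldr (f := fun x y s => f x y :: s)); repeat prb.
  by apply: (PR_comp (f := fun p => f p.1 p.2)); repeat prb.
by move=> x; elim: (l x) => //= y s ->.
Qed.

Lemma PR_has `{code X, code A} (f : X -> A -> bool) (l : X -> seq A) :
  PR (fun p => f p.1 p.2) -> PR l ->
  PR (fun x => has (f x) (l x)).
Proof.
move=> F L; apply: PR_ext (_ : PR (fun x => foldr (fun y s => f x y || s) false (l x))) _.
  apply: (PR_foldr (f := fun x y s => f x y || s)); repeat prb.
  apply: PR_or; last by repeat prb.
  by apply: (PR_comp (f := fun p => f p.1 p.2)); repeat prb.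
by move=> x; elim: (l x) => //= y s ->.
Qed.

Lemma PR_all `{code X, code A} (f : X -> A -> bool) (l : X -> seq A) :
  PR (fun p => f p.1 p.2) -> PR l ->
  PR (fun x => all (f x) (l x)).
Proof.
move=> F L; apply: PR_ext (_ : PR (fun x => ~~ has (fun y => ~~ f x y) (l x))) _.
  apply: PR_neg; apply: (PR_has (f := fun x y => ~~ f x y)) => //.
  by apply: PR_neg.
by move=> x; rewrite has_predC negbK.
Qed.

Lemma PR_filter `{code X, code A} (f : X -> A -> bool) (l : X -> seq A) :
  PR (fun p => f p.1 p.2) -> PR l ->
  PR (fun x => [seq y <- l x | f x y]).
Proof.
move=> F L.
apply: PR_ext (_ : PR (fun x => foldr (fun y s => if f x y then y :: s else s) [::] (l x))) _.
  apply: (PR_foldr (f := fun x y s => if f x y then y :: s else s)); repeat prb.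
  by apply: (PR_comp (f := fun p => f p.1 p.2)); repeat prb.
by move=> x; elim: (l x) => //= y s ->.
Qed.

Lemma PR_cat `{code X, code A} (f g : X -> seq A) : PR f -> PR g -> PR (fun x => f x ++ g x).
Proof.
move=> F G; apply: PR_ext (_ : PR (fun x => foldr cons (g x) (f x))) _.
  by apply: PR_foldr; repeat prb.
by move=> x; elim: (f x) => //= y s ->.
Qed.

Lemma PR_flatten `{code X, code A} (f : X -> seq (seq A)) : PR f -> PR (fun x => flatten (f x)).
Proof.
by move=> F; apply: PR_foldr; repeat prb; apply: PR_cat; repeat prb.
Qed.

Lemma PR_rcons `{code X, code A} (f : X -> seq A) (g : X -> A) : PR f -> PR g -> PR (fun x => rcons (f x) (g x)).
Proof.
move=> F G; apply: PR_ext (_ : PR (fun x => f x ++ [:: g x])) _.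
  by apply: PR_cat; repeat prb.
by move=> x; rewrite cats1.
Qed.

Lemma PR_size `{code X, code A} (f : X -> seq A) : PR f -> PR (fun x => size (f x)).
Proof.
by move=> F; apply: PR_ext (_ : PR (fun x => foldr (fun _ => succn) 0 (f x))) _;
  [apply: PR_foldr; repeat prb | move=> x; elim: (f x) => //= y s ->].
Qed.

Lemma PR_drop `{code X, code A} (n : X -> nat) (f : X -> seq A) : PR n -> PR f -> PR (fun x => drop (n x) (f x)).
Proof.
move=> N F; apply: PR_ext (_ : PR (fun x => iter (n x) behead (f x))) _.
  by apply: PR_iter => //; apply: PR_behead; repeat prb.
by move=> x; elim: (n x) (f x) => [|m IH] s; rewrite ?drop0 // iterSr IH; case: s.
Qed.

Lemma PR_nth `{code X, code A} (d : X -> A) (f : X -> seq A) (n : X -> nat) :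
  PR d -> PR f -> PR n ->
  PR (fun x => nth (d x) (f x) (n x)).
Proof.
move=> P F N; apply: PR_ext (_ : PR (fun x => head (d x) (drop (n x) (f x)))) _.
  by apply: PR_head => //; apply: PR_drop.
by move=> x; rewrite -nth0 nth_drop addn0.
Qed.

Lemma PR_iota `{code X} (n : X -> nat) : PR n -> PR (fun x => iota 0 (n x)).
Proof.
move=> N; apply: PR_ext (_ : PR (fun x => iter (n x) (fun s => rcons s (size s)) [::])) _.
  by apply: PR_iter; repeat prb; apply: PR_rcons; [|apply: PR_size]; repeat prb.
by move=> x; elim: (n x) => // m IH; rewrite iterS IH size_iota -cats1 -addn1 iotaD.
Qed.

(** Equality of structured data is tested on codes, which is faithful when coding is injective. *)
Class injcode (T : eqType) {c : code T} := inj_cod : injective (cod : T -> nat).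
Arguments injcode T {c}.
#[local] Instance inj_nat : injcode nat. Proof. by []. Qed.
#[local] Instance inj_pair (A B : eqType) {ca : code A} {cb : code B} {ia : injcode A}
  {ib : injcode B} : injcode (A * B)%type.
Proof.
move=> [a b] [a' b'] E; have := congr1 c1 E; have := congr1 c2 E.
by rewrite /cod /code_pair !c1K !c2K /= => /inj_cod -> /inj_cod ->.
Qed.
#[local] Instance inj_seq (A : eqType) {ca : code A} {ia : injcode A} : injcode (seq A).
Proof.
elim=> [|a s IH] [|b t] // [E]; have := congr1 c1 E; have := congr1 c2 E.
by rewrite !c1K !c2K => /IH -> /inj_cod ->.
Qed.

Section EqTypes.
Context {X : Type} {A : eqType} {cx : code X} {ca : code A} {ia : injcode A}.

Lemma PR_eq (f g : X -> A) : PR f -> PR g -> PR (fun x => f x == g x).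
Proof.
move=> F G; apply: PR_ext (_ : PR (fun x => cod (f x) == cod (g x))) _.
  apply: PR_eqn.
    by case: F => f' F Ff; exists f'.
  by case: G => g' G Gg; exists g'.
by move=> x; rewrite (inj_eq inj_cod).
Qed.
End EqTypes.

Lemma PR_mem {X : Type} {A : eqType} {cx : code X} {ca : code A} {ia : injcode A}
  (f : X -> A) (l : X -> seq A) : PR f -> PR l -> PR (fun x => f x \in l x).
Proof.
move=> F L; apply: PR_ext (_ : PR (fun x => has (fun y => y == f x) (l x))) _.
  apply: (PR_has (f := fun x y => y == f x)) => //.
  by apply: PR_eq; repeat prb.
by move=> x; rewrite has_pred1.
Qed.

(** * The decision procedure *)

(** Backward closure of the final states; [nfa_n A] rounds suffice since a path can be taken without
    repeated states. *)
Definition coacc (A : nfa) : seq nat :=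
  iter (nfa_n A) (fun l => l ++ [seq t.1.1 | t <- nfa_tr A & t.2 \in l]) (nfa_fin A).

(** Filtering [iota] gives each set of states a single representation, so that equality of lists is
    equality of sets. *)
Definition dstep (A : nfa) (S : seq nat) (a : nat) : seq nat :=
  [seq p <- iota 0 (nfa_n A) |
    has (fun t => [&& t.1.1 \in S, t.1.2 == a & t.2 == p]) (nfa_tr A)].

Definition dst (A : nfa) (u : seq nat) : seq nat :=
  foldl (dstep A) [seq p <- iota 0 (nfa_n A) | p \in nfa_init A] u.

Definition viable (A : nfa) (u : seq nat) : bool := has (fun p => p \in coacc A) (dst A u).

Definition inst := (fifo * seq nfa)%type.

(* Control state and, for each channel, the word sent so far with the number of
   letters already received: the content is the remaining suffix. *)
Definition hist := (nat * seq (seq nat * nat))%type.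

Definition chan (e : hist) (c : nat) : seq nat * nat := nth ([::], 0) e.2 c.
Definition len (e : hist) c := size (chan e c).1 - (chan e c).2.
Definition aut (I : inst) c := nth nfa0 I.2 c.

Definition setc (n : nat) (e : hist) c ch : seq (seq nat * nat) :=
  [seq if j == c then ch else chan e j | j <- iota 0 n].

(** A send is allowed only if the word sent remains a prefix of an accepted word; this builds the
    restriction to [Pref(L_!)] into the histories. *)
Definition fire (I : inst) (e : hist) (t : nat * act * nat) : seq hist :=
  let c := t.1.2.1.1 in
  if t.1.1 == e.1 then
    if t.1.2.1.2 then
      if viable (aut I c) (rcons (chan e c).1 t.1.2.2) then
        [:: (t.2, setc (nch I.1) e c (rcons (chan e c).1 t.1.2.2, (chan e c).2))]
      else [::]
    else if ((chan e c).2 < size (chan e c).1) && (nth 0 (chan e c).1 (chan e c).2 == t.1.2.2)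
      then [:: (t.2, setc (nch I.1) e c ((chan e c).1, (chan e c).2.+1))]
      else [::]
  else [::].

Definition succs (I : inst) (e : hist) : seq hist :=
  flatten [seq fire I e t | t <- delta I.1].

Definition start (I : inst) : hist := (q0 I.1, [seq ([::], 0) | c <- iota 0 (nch I.1)]).

Definition key (I : inst) (e : hist) : nat * seq (seq nat * seq nat) :=
  (e.1, [seq (drop (chan e c).2 (chan e c).1, dst (aut I c) (chan e c).1)
        | c <- iota 0 (nch I.1)]).

(** Traces are stored newest history first, so the ancestors of a trace are its suffixes. *)
Definition extend (I : inst) (tr : seq hist) : seq (seq hist) :=
  [seq e :: tr | e <- [seq e <- succs I (head (start I) tr) |
                         key I e \notin [seq key I e' | e' <- tr]]].

Definition level (I : inst) (n : nat) : seq (seq hist) :=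
  iter n (fun L => flatten [seq extend I tr | tr <- L]) [:: [:: start I]].

Definition divides d n := has (fun k => k * d == n) (iota 0 n.+1).

Definition periodic_from d r (u : seq nat) :=
  all (fun i => [|| i < r, size u <= i + d | nth 0 u i == nth 0 u (i + d)]) (iota 0 (size u)).

(** Either the loop receives nothing on [c], or it sends and receives whole numbers of periods of a
    word that is periodic from the read position of [e] on. *)
Definition steady (e e' : hist) c :=
  ((chan e c).2 == (chan e' c).2) ||
  has (fun d => [&& 0 < d, divides d (size (chan e' c).1 - size (chan e c).1),
                    divides d ((chan e' c).2 - (chan e c).2) &
                    periodic_from d (chan e c).2 (chan e' c).1])
      (iota 0 (size (chan e' c).1).+1).

(** Comparing lengths is enough when [e'] is reached from [e]: without receptions a content only
    grows at its end, and otherwise [steady] puts both contents at the same phase of one periodic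
    word. In both cases the earlier content is a prefix of the later. *)
Definition pump (I : inst) (e e' : hist) :=
  [&& e.1 == e'.1,
      all (fun c => [&& dst (aut I c) (chan e c).1 == dst (aut I c) (chan e' c).1,
                        len e c <= len e' c & steady e e' c]) (iota 0 (nch I.1)) &
      has (fun c => len e c < len e' c) (iota 0 (nch I.1))].

Definition pumpable (I : inst) (tr : seq hist) :=
  has (fun e => pump I e (head (start I) tr)) tr.

(** In the format of [cmp_search]: 1 means finite, 2 means infinite, 0 means that depth [n] is
    inconclusive. *)
Definition answer (I : inst) (n : nat) : nat :=
  if size (level I n) == 0 then 1 else if has (fun tr => pumpable I tr) (level I n) then 2 else 0.

(** * Computability of the decision procedure *)

Section Projections.
Context {X : Type} {cx : code X}.

Lemma cmp_nth i : cmp (fun n => c1 (iter i (fun m => c2 m.-1) n).-1).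
Proof.
have H : cmp (fun n => iter i (fun m => c2 m.-1) n).
  elim: i => [|i IH]; first exact: cmp_id.
  exact: cmp_comp (cmp_comp cmp_snd cmp_pred) IH.
exact: cmp_comp cmp_fst (cmp_comp cmp_pred H).
Qed.

(** A record is coded as the list [v] of the codes of its fields, so a projection amounts to
    extracting the [i]-th entry. *)
Lemma PR_nthcode A B {ca : code A} {cb : code B} (f : A -> B) (v : A -> seq nat) i (g : X -> A) :
  (forall a, cod a = enc_seq (v a)) -> (forall a, i < size (v a)) ->
  (forall a, nth 0 (v a) i = cod (f a)) -> PR g -> PR (fun x => f (g x)).
Proof.
move=> E sz Ef; apply: PR_comp; exists (fun n => c1 (iter i (fun m => c2 m.-1) n).-1).
  exact: cmp_nth.
move=> a; rewrite E -Ef; move: (v a) (sz a) => {}v {E Ef}sz.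
elim: i v sz => [|i IH] [|n l] // h; first by rewrite /= c1K.
by rewrite iterSr [(enc_seq _).-1]/= c2K IH.
Qed.

Let fifo_fields M := [:: nstates M; q0 M; nch M; enc_seq (alph M); enc_seq (map enc_ftr (delta M))].
Let nfa_fields A := [:: nfa_n A; enc_seq (nfa_init A); enc_seq (nfa_fin A);
                        enc_seq (map enc_ntr (nfa_tr A))].

Lemma PR_nch (g : X -> fifo) : PR g -> PR (fun x => nch (g x)).
Proof. by apply: (PR_nthcode (v := fifo_fields) (i := 2)). Qed.

Lemma PR_q0 (g : X -> fifo) : PR g -> PR (fun x => q0 (g x)).
Proof. by apply: (PR_nthcode (v := fifo_fields) (i := 1)). Qed.

Lemma PR_delta (g : X -> fifo) : PR g -> PR (fun x => delta (g x)).
Proof.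
apply: (PR_nthcode (v := fifo_fields) (i := 4)) => //.
move=> M; rewrite /=; congr enc_seq; apply: eq_map => -[[q [[c b] a]] q']; reflexivity.
Qed.

Lemma PR_nfa_n (g : X -> nfa) : PR g -> PR (fun x => nfa_n (g x)).
Proof. by apply: (PR_nthcode (v := nfa_fields) (i := 0)). Qed.

Lemma PR_nfa_init (g : X -> nfa) : PR g -> PR (fun x => nfa_init (g x)).
Proof.
apply: (PR_nthcode (v := nfa_fields) (i := 1)) => //.
by move=> A; rewrite /=; congr enc_seq; rewrite -[LHS]map_id.
Qed.

Lemma PR_nfa_fin (g : X -> nfa) : PR g -> PR (fun x => nfa_fin (g x)).
Proof.
apply: (PR_nthcode (v := nfa_fields) (i := 2)) => //.
by move=> A; rewrite /=; congr enc_seq; rewrite -[LHS]map_id.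
Qed.

Lemma PR_nfa_tr (g : X -> nfa) : PR g -> PR (fun x => nfa_tr (g x)).
Proof.
apply: (PR_nthcode (v := nfa_fields) (i := 3)) => //.
move=> A; rewrite /=; congr enc_seq; apply: eq_map => -[[p a] p']; reflexivity.
Qed.

End Projections.


(** Through these classes instance search finds the computability of a curried function that has
    already been treated. *)
Class PR1 `{code A, code B} (f : A -> B) := pr1 : PR f.
Class PR2 `{code A, code B, code C} (f : A -> B -> C) := pr2 : PR (fun p => f p.1 p.2).
Class PR3 `{code A, code B, code C, code D} (f : A -> B -> C -> D) :=
  pr3 : PR (fun p => f p.1.1 p.1.2 p.2).
Class PR4 `{code A, code B, code C, code D, code E} (f : A -> B -> C -> D -> E) :=
  pr4 : PR (fun p => f p.1.1.1 p.1.1.2 p.1.2 p.2).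

Lemma PR_app1 `{code X, code A, code B} (f : A -> B) {_ : PR1 f} (a : X -> A) :
  PR a -> PR (fun x => f (a x)).
Proof. exact: PR_comp. Qed.

Lemma PR_app2 `{code X, code A, code B, code C} (f : A -> B -> C) {_ : PR2 f}
  (a : X -> A) (b : X -> B) : PR a -> PR b -> PR (fun x => f (a x) (b x)).
Proof.
move=> Pa Pb.
exact: (PR_comp (f := fun p => f p.1 p.2) (g := fun x => (a x, b x)) pr2 (PR_pair Pa Pb)).
Qed.

Lemma PR_app3 `{code X, code A, code B, code C, code D} (f : A -> B -> C -> D) {_ : PR3 f}
  (a : X -> A) (b : X -> B) (c : X -> C) :
  PR a -> PR b -> PR c -> PR (fun x => f (a x) (b x) (c x)).
Proof.
move=> Pa Pb Pc.
exact: (PR_comp (f := fun p => f p.1.1 p.1.2 p.2) (g := fun x => (a x, b x, c x)) pr3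
  (PR_pair (PR_pair Pa Pb) Pc)).
Qed.

Lemma PR_app4 `{code X, code A, code B, code C, code D, code E} (f : A -> B -> C -> D -> E)
  {_ : PR4 f} (a : X -> A) (b : X -> B) (c : X -> C) (d : X -> D) :
  PR a -> PR b -> PR c -> PR d -> PR (fun x => f (a x) (b x) (c x) (d x)).
Proof.
move=> Pa Pb Pc Pd.
exact: (PR_comp (f := fun p => f p.1.1.1 p.1.1.2 p.1.2 p.2)
  (g := fun x => (a x, b x, c x, d x)) pr4 (PR_pair (PR_pair (PR_pair Pa Pb) Pc) Pd)).
Qed.

Ltac prt := cbv beta; lazymatch goal with
  | |- PR (fun x => filter (fun y => @?f x y) (@?l x)) => refine (PR_filter (f := f) (l := l) _ _)
  | |- PR (fun x => map (fun y => @?f x y) (@?l x)) => refine (PR_map (f := f) (l := l) _ _)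
  | |- PR (fun x => has (fun y => @?f x y) (@?l x)) => refine (PR_has (f := f) (l := l) _ _)
  | |- PR (fun x => all (fun y => @?f x y) (@?l x)) => refine (PR_all (f := f) (l := l) _ _)
  | |- PR (fun x => iter (@?n x) (fun y => @?f x y) (@?a x)) =>
      refine (PR_iter (n := n) (f := f) (a := a) _ _ _)
  | |- PR (fun x => flatten (@?f x)) => refine (PR_flatten (f := f) _)
  | |- PR (fun x => size (@?f x)) => refine (PR_size (f := f) _)
  | |- PR (fun x => cat (@?f x) (@?g x)) => refine (PR_cat (f := f) (g := g) _ _)
  | |- PR (fun x => rcons (@?f x) (@?g x)) => refine (PR_rcons (f := f) (g := g) _ _)
  | |- PR (fun x => drop (@?f x) (@?g x)) => refine (PR_drop (n := f) (f := g) _ _)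
  | |- PR (fun x => nth (@?d x) (@?f x) (@?n x)) => refine (PR_nth (d := d) (f := f) (n := n) _ _ _)
  | |- PR (fun x => head (@?d x) (@?f x)) => refine (PR_head (d := d) (g := f) _ _)
  | |- PR (fun x => iota 0 (@?n x)) => refine (PR_iota (n := n) _)
  | |- PR (fun x => addn (@?f x) (@?g x)) => refine (PR_add (f := f) (g := g) _ _)
  | |- PR (fun x => subn (@?f x) (@?g x)) => refine (PR_sub (f := f) (g := g) _ _)
  | |- PR (fun x => muln (@?f x) (@?g x)) => refine (PR_mul (f := f) (g := g) _ _)
  | |- PR (fun x => leq (@?f x) (@?g x)) => refine (PR_leq (f := f) (g := g) _ _)
  | |- PR (fun x => andb (@?f x) (@?g x)) => refine (PR_and (f := f) (g := g) _ _)
  | |- PR (fun x => orb (@?f x) (@?g x)) => refine (PR_or (f := f) (g := g) _ _)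
  | |- PR (fun x => negb (@?f x)) => refine (PR_neg (f := f) _)
  | |- PR (fun x => eq_op (@?f x) (@?g x)) => refine (PR_eq (f := f) (g := g) _ _)
  | |- PR (fun x => in_mem (@?f x) (mem (@?l x))) => refine (PR_mem (f := f) (l := l) _ _)
  | |- PR (fun x => nch (@?g x)) => refine (PR_nch (g := g) _)
  | |- PR (fun x => q0 (@?g x)) => refine (PR_q0 (g := g) _)
  | |- PR (fun x => delta (@?g x)) => refine (PR_delta (g := g) _)
  | |- PR (fun x => nfa_n (@?g x)) => refine (PR_nfa_n (g := g) _)
  | |- PR (fun x => nfa_init (@?g x)) => refine (PR_nfa_init (g := g) _)
  | |- PR (fun x => nfa_fin (@?g x)) => refine (PR_nfa_fin (g := g) _)
  | |- PR (fun x => nfa_tr (@?g x)) => refine (PR_nfa_tr (g := g) _)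
  | |- PR (fun x => ?f (@?a x) (@?b x) (@?c x) (@?d x)) =>
      first [ prb | refine (PR_app4 (f := f) (a := a) (b := b) (c := c) (d := d) _ _ _ _) ]
  | |- PR (fun x => ?f (@?a x) (@?b x) (@?c x)) =>
      first [ prb | refine (PR_app3 (f := f) (a := a) (b := b) (c := c) _ _ _) ]
  | |- PR (fun x => ?f (@?a x) (@?b x)) =>
      first [ prb | refine (PR_app2 (f := f) (a := a) (b := b) _ _) ]
  | |- PR (fun x => ?f (@?a x)) => first [ prb | refine (PR_app1 (f := f) (a := a) _) ]
  | |- PR ?f => first [ prb | exact: (pr1 (f := f)) ]
  end.

#[local] Instance PR_coacc : PR1 coacc.
Proof. rewrite /PR1 /coacc; repeat prt. Qed.

#[local] Instance PR_dstep : PR3 dstep.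
Proof. rewrite /PR3 /dstep; repeat prt. Qed.

#[local] Instance PR_dst : PR2 dst.
Proof.
rewrite /PR2 /dst; apply: (PR_foldl (f := fun p => dstep p.1)); repeat prt. 
Qed.

#[local] Instance PR_viable : PR2 viable.
Proof. rewrite /PR2 /viable; repeat prt. Qed.

#[local] Instance PR_chan : PR2 chan.
Proof. rewrite /PR2 /chan; repeat prt. Qed.

#[local] Instance PR_len : PR2 len.
Proof. rewrite /PR2 /len; repeat prt. Qed.

#[local] Instance PR_aut : PR2 aut.
Proof. rewrite /PR2 /aut; repeat prt. Qed.

#[local] Instance PR_setc : PR4 setc.
Proof. rewrite /PR4 /setc; repeat prt. Qed.

#[local] Instance PR_fire : PR3 fire.
Proof. rewrite /PR3 /fire; repeat prt. Qed.

#[local] Instance PR_succs : PR2 succs.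
Proof. rewrite /PR2 /succs; repeat prt. Qed.

#[local] Instance PR_start : PR1 start.
Proof. rewrite /PR1 /start; repeat prt. Qed.

#[local] Instance PR_key : PR2 key.
Proof. rewrite /PR2 /key; repeat prt. Qed.

#[local] Instance PR_extend : PR2 extend.
Proof. rewrite /PR2 /extend; repeat prt. Qed.

#[local] Instance PR_level : PR2 level.
Proof. rewrite /PR2 /level; repeat prt. Qed.

#[local] Instance PR_divides : PR2 divides.
Proof. rewrite /PR2 /divides; repeat prt. Qed.

#[local] Instance PR_periodic_from : PR3 periodic_from.
Proof. rewrite /PR3 /periodic_from; repeat prt. Qed.

#[local] Instance PR_steady : PR3 steady.
Proof. rewrite /PR3 /steady; repeat prt. Qed.

#[local] Instance PR_pump : PR3 pump.
Proof. rewrite /PR3 /pump; repeat prt. Qed.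

#[local] Instance PR_pumpable : PR2 pumpable.
Proof. rewrite /PR2 /pumpable; repeat prt. Qed.

Lemma PR_answer : PR2 answer.
Proof. rewrite /PR2 /answer; repeat prt. Qed.

(** * Input automata and histories *)

Section Automata.
Variables (A : nfa) (sig : nat).
Hypothesis wfA : nfa_wf A sig.

Definition nfa_edge : rel nat :=
  fun p p' => has (fun t => (t.1.1 == p) && (t.2 == p')) (nfa_tr A).

Lemma nfa_edgeP p p' : reflect (exists a, (p, a, p') \in nfa_tr A) (nfa_edge p p').
Proof.
apply: (iffP hasP) => [[[[q a] q'] h /andP[/eqP /= <- /eqP <-]]|[a h]]; first by exists a.
by exists (p, a, p'); rewrite ?eqxx.
Qed.

Lemma nfa_tr_bound p a p' : (p, a, p') \in nfa_tr A -> p < nfa_n A /\ p' < nfa_n A.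
Proof. by case: wfA => _ [_ /allP /(_ (p, a, p'))] H /H /and3P[]. Qed.

Lemma nfa_path_cat p u p' v p'' :
  nfa_path A p u p' -> nfa_path A p' v p'' -> nfa_path A p (u ++ v) p''.
Proof. by elim=> // {}p a q w q' h _ IH /IH; exact: np_cons. Qed.

Lemma nfa_path_split u v p p'' : nfa_path A p (u ++ v) p'' ->
  exists2 p', nfa_path A p u p' & nfa_path A p' v p''.
Proof.
elim: u p => [|a u IH] p /= h; first by exists p; first exact: np_nil.
inversion h; subst; have [p1 h1 h2] := IH _ H4.
by exists p1 => //; apply: np_cons h1; eassumption.
Qed.

Lemma nfa_path_edges p w p' : nfa_path A p w p' -> exists2 s, path nfa_edge p s & last p s = p'.
Proof.
elim=> [q|q a q' w0 q'' h _ [s hs ls]]; first by exists [::].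
by exists (q' :: s) => //=; rewrite hs andbT; apply/nfa_edgeP; exists a.
Qed.

Let back l := l ++ [seq t.1.1 | t <- nfa_tr A & t.2 \in l].

Lemma coacc_sound n p : p \in iter n back (nfa_fin A) ->
  exists w p', p' \in nfa_fin A /\ nfa_path A p w p'.
Proof.
elim: n p => [|n IH] p /=; first by move=> h; exists [::], p; split; last exact: np_nil.
rewrite mem_cat => /orP[/IH //|/mapP[[[q a] q'] /=]].
rewrite mem_filter => /andP[/IH[w [p' [f h]]] t ->].
by exists (a :: w), p'; split=> //; apply: np_cons h.
Qed.

Lemma coacc_mono n m p : n <= m -> p \in iter n back (nfa_fin A) -> p \in iter m back (nfa_fin A).
Proof.
move=> /subnKC <-; elim: (m - n) => [|k IH] h; first by rewrite addn0.
by rewrite addnS /= mem_cat IH.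
Qed.

Lemma coacc_edges s p : path nfa_edge p s -> last p s \in nfa_fin A ->
  p \in iter (size s) back (nfa_fin A).
Proof.
elim: s p => [|q s IH] p //= /andP[/nfa_edgeP[a t] h] l.
rewrite mem_cat; apply/orP; right; apply/mapP; exists (p, a, q) => //.
by rewrite mem_filter t andbT; exact: IH.
Qed.

Lemma coaccP p : p \in coacc A <-> exists w p', p' \in nfa_fin A /\ nfa_path A p w p'.
Proof.
split; first exact: coacc_sound.
move=> [w [p' [f /nfa_path_edges[s hs ls]]]].
(* A duplicate-free path visits at most [nfa_n A] states, which bounds the number of rounds. *)
case/shortenP: hs ls => s' hs' us' _ ls'.
apply: (@coacc_mono (size s')); last by apply: coacc_edges hs' _; rewrite ls'.
case: s' hs' us' {ls'} => [|q s'] // hs' us'.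
have sub : {subset p :: q :: s' <= iota 0 (nfa_n A)}.
  move: hs'; elim: s' p q {us' w f} => [|q' s' IH] p q /=.
    by move=> /andP[/nfa_edgeP[a /nfa_tr_bound[h1 h2]] _] x; rewrite !inE => /orP[]/eqP->;
      rewrite mem_iota.
  move=> /andP[/nfa_edgeP[a /nfa_tr_bound[h1 h2]] h] x; rewrite inE => /orP[/eqP->|].
    by rewrite mem_iota.
  exact: IH.
by have := uniq_leq_size us' sub; rewrite size_iota /= => /ltnW.
Qed.

Lemma dst_rcons u a : dst A (rcons u a) = dstep A (dst A u) a.
Proof. by rewrite /dst -cats1 foldl_cat. Qed.

Lemma mem_dstep S a p : p \in dstep A S a <-> exists2 q, q \in S & (q, a, p) \in nfa_tr A.
Proof.
rewrite mem_filter; split.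
  by move=> /andP[/hasP[[[q b] q'] t /and3P[/= h /eqP <- /eqP <-]] _]; exists q.
move=> [q h t]; apply/andP; split.
  by apply/hasP; exists (q, a, p) => //=; rewrite h !eqxx.
by rewrite mem_iota; case: (nfa_tr_bound t).
Qed.

Lemma mem_dst u p : p \in dst A u <-> exists2 q, q \in nfa_init A & nfa_path A q u p.
Proof.
elim/last_ind: u p => [|u a IH] p.
  rewrite /dst /= mem_filter; split=> [/andP[h _]|[q h hp]].
    by exists p => //; exact: np_nil.
  inversion hp; subst; rewrite h mem_iota /= add0n.
  by case: wfA => /allP /(_ _ h).
rewrite dst_rcons mem_dstep; split=> [[q /IH[q0 h hp] t]|[q0 h]].
  exists q0 => //; rewrite -cats1; apply: nfa_path_cat hp _.
  by apply: np_cons t _; exact: np_nil.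
rewrite -cats1 => /nfa_path_split[q hp h1].
inversion h1; subst; inversion H4; subst.
by exists q => //; apply/IH; exists q0.
Qed.

Lemma viableP u : viable A u <-> exists v, nfa_accepts A (u ++ v).
Proof.
split=> [/hasP[p /mem_dst[q h hp] /coaccP[w [p' [f hp']]]]|[v [p [p' [h f]]]]].
  by exists w, q, p'; split=> //; apply: nfa_path_cat hp hp'.
move=> /nfa_path_split[q h1 h2]; apply/hasP; exists q.
  by apply/mem_dst; exists p.
by apply/coaccP; exists v, p'.
Qed.

Lemma viable_catl u v : viable A (u ++ v) -> viable A u.
Proof. by move=> /viableP[w]; rewrite -catA => h; apply/viableP; exists (v ++ w). Qed.

Lemma dst_eq u v : (forall p, p < nfa_n A -> (p \in dst A u) = (p \in dst A v)) ->
  dst A u = dst A v.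
Proof.
have H w : dst A w = [seq p <- iota 0 (nfa_n A) | p \in dst A w].
  case/lastP: w => [|w a]; first
    by rewrite /dst /=; apply: eq_in_filter => p pn; rewrite mem_filter pn andbT.
  rewrite dst_rcons {1}/dstep; apply: eq_in_filter => p pn.
  by rewrite [RHS]mem_filter pn andbT.
move=> E; rewrite H [RHS]H; apply: eq_in_filter => p; rewrite mem_iota add0n => /andP[_].
exact: E.
Qed.

End Automata.

(** * Histories and FIFO runs *)

Section Histories.
Variables (M : fifo) (As : seq nfa).
Hypothesis wfM : instance_wf M As.
Hypothesis prM : instance_promise M As.
Let I : inst := (M, As).
Let N := nch M.

Lemma aut_wf c : c < N -> nfa_wf (aut I c) (nth 0 (alph M) c).
Proof. by case: wfM => _ [_]; apply. Qed.

Lemma delta_wf q c b a q' : (q, (c, b, a), q') \in delta M ->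
  [/\ q < nstates M, q' < nstates M, c < N & a < nth 0 (alph M) c].
Proof. by case: wfM => -[_ [_ /allP H]] _ /H /and4P. Qed.

Lemma chan_map q f c : c < N -> chan (q, [seq f j | j <- iota 0 N]) c = f c.
Proof. by move=> h; rewrite /chan /= (nth_map 0) ?size_iota // nth_iota. Qed.

Lemma chan_setc q e c ch j : j < N ->
  chan (q, setc N e c ch) j = if j == c then ch else chan e j.
Proof. exact: chan_map. Qed.

Lemma chan_start c : c < N -> chan (start I) c = ([::], 0).
Proof. exact: chan_map. Qed.

Variant move (e : hist) : hist -> Prop :=
  | MSend c a q' : (e.1, (c, true, a), q') \in delta M -> c < N ->
      viable (aut I c) (rcons (chan e c).1 a) ->
      move e (q', setc N e c (rcons (chan e c).1 a, (chan e c).2))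
  | MRecv c a q' : (e.1, (c, false, a), q') \in delta M -> c < N ->
      (chan e c).2 < size (chan e c).1 -> nth 0 (chan e c).1 (chan e c).2 = a ->
      move e (q', setc N e c ((chan e c).1, (chan e c).2.+1)).

Lemma succsP e e' : e' \in succs I e <-> move e e'.
Proof.
split.
  move=> /flattenP[s /mapP[[[q [[c b] a]] q'] t ->]].
  rewrite /fire /=; case: eqP => // E; subst q.
  have [_ _ cN _] := delta_wf t.
  case: b t => t.
    case: ifP => // v; rewrite inE => /eqP ->; exact: MSend t _ v.
  case: ifP => // /andP[h /eqP h']; rewrite inE => /eqP ->; exact: MRecv t _ h h'.
case=> c a q' t cN.
  move=> v; apply/flattenP; exists (fire I e (e.1, (c, true, a), q')); first exact: map_f.
  by rewrite /fire /= eqxx v inE.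
move=> h h'; apply/flattenP; exists (fire I e (e.1, (c, false, a), q')); first exact: map_f.
by rewrite /fire /= eqxx h h' eqxx inE.
Qed.

Inductive steps (e : hist) : hist -> Prop :=
  | steps0 : steps e e
  | stepsS e' e'' : steps e e' -> move e' e'' -> steps e e''.

Lemma steps_trans e e' e'' : steps e e' -> steps e' e'' -> steps e e''.
Proof. by move=> h; elim=> // x y _ IH m; exact: stepsS IH m. Qed.

Definition contents (e : hist) : config :=
  (e.1, [seq drop (chan e c).2 (chan e c).1 | c <- iota 0 N]).

Lemma size_contents e c : c < N -> size (nth [::] (contents e).2 c) = len e c.
Proof. by move=> h; rewrite (nth_map 0) ?size_iota // nth_iota // size_drop. Qed.

Lemma set_nth_map (f : nat -> seq nat) c y : c < N ->
  set_nth [::] [seq f j | j <- iota 0 N] c y = [seq if j == c then y else f j | j <- iota 0 N].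
Proof.
move=> cN; apply: (@eq_from_nth _ [::]).
  by rewrite size_set_nth !size_map size_iota; apply/maxn_idPr.
move=> i; rewrite size_set_nth size_map size_iota (maxn_idPr cN) => iN.
by rewrite nth_set_nth /= !(nth_map 0) ?size_iota // nth_iota.
Qed.

Lemma contents_setc q e c ch : c < N ->
  contents (q, setc N e c ch) = (q, set_nth [::] (contents e).2 c (drop ch.2 ch.1)).
Proof.
move=> cN; rewrite /contents set_nth_map //; congr pair.
apply/eq_in_map => j; rewrite mem_iota add0n => /andP[_ jN].
by rewrite chan_setc //; case: ifP.
Qed.

Definition sane (e : hist) := forall c, c < N ->
  (chan e c).2 <= size (chan e c).1 /\ viable (aut I c) (chan e c).1.

Lemma sane_start : sane (start I).
Proof.
move=> c cN; rewrite chan_start //; split=> //.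
apply/(viableP (aut_wf cN)); case: (prM cN) => -[w h] _; by exists w.
Qed.

Lemma sane_move e e' : sane e -> move e e' -> sane e'.
Proof.
move=> H [c a q' t cN v|c a q' t cN h h'] j jN; rewrite chan_setc //; have [h1 h2] := H _ jN.
  by case: eqP => [->|//]; rewrite /= size_rcons; split=> //; apply: leqW; case: (H _ cN).
by case: eqP => [->|//]; split=> //; case: (H _ cN).
Qed.

Lemma sane_steps e e' : sane e -> steps e e' -> sane e'.
Proof. by move=> h; elim=> // x y _ IH m; exact: sane_move IH m. Qed.

Lemma reachable_sane e : steps (start I) e -> sane e.
Proof. exact: sane_steps sane_start. Qed.

Lemma fifo_run_rcons cf s x cf' cf'' :
  fifo_run M cf s cf' -> fifo_step M cf' x cf'' -> fifo_run M cf (rcons s x) cf''.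
Proof.
elim=> [c0|c0 y c1 t c2 st _ IH] h /=.
  by apply: run_cons h _; exact: run_nil.
by apply: run_cons st _; exact: IH.
Qed.

Lemma fifo_run_split cf s x cf'' : fifo_run M cf (rcons s x) cf'' ->
  exists2 cf', fifo_run M cf s cf' & fifo_step M cf' x cf''.
Proof.
elim: s cf => [|y s IH] cf /= h; inversion h; subst.
  by inversion H4; subst; exists cf; first exact: run_nil.
have [c0 h1 h2] := IH _ H4; exists c0 => //; exact: run_cons H2 h1.
Qed.

Lemma send_proj_rcons c s c' b a : send_proj c (rcons s (c', b, a)) =
  if (c' == c) && b then rcons (send_proj c s) a else send_proj c s.
Proof. by rewrite /send_proj filter_rcons /=; case: ifP => // _; rewrite map_rcons. Qed.

Lemma step_move e x cf' : fifo_step M (contents e) x cf' ->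
  (x.1.2 -> viable (aut I x.1.1) (rcons (chan e x.1.1).1 x.2)) -> sane e ->
  exists e', [/\ move e e', contents e' = cf' & forall c, c < N ->
    (chan e' c).1 = if (x.1.1 == c) && x.1.2 then rcons (chan e c).1 x.2 else (chan e c).1].
Proof.
case: x => [[c b] a]; case: cf' => q' w' [t cN].
have nE : nth [::] (contents e).2 c = drop (chan e c).2 (chan e c).1.
  by rewrite (nth_map 0) ?size_iota // nth_iota.
case: b t => t /= E v sn; have [h1 _] := sn _ cN.
  eexists; split; first exact: MSend t _ (v isT).
    by rewrite contents_setc //= drop_rcons // -nE E.
  by move=> j jN; rewrite chan_setc // andbT [c == j]eq_sym; case: eqP => [->|].
case: E => u [E ->]; rewrite nE in E.
have lt : (chan e c).2 < size (chan e c).1.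
  by rewrite ltnNge; apply/negP => /drop_oversize; rewrite E.
eexists; split; first apply: (MRecv t) => //.
- by rewrite -[_.2]addn0 -nth_drop E.
- by rewrite contents_setc //= -add1n -drop_drop E /= drop0.
- by move=> j jN; rewrite chan_setc // andbF; case: eqP => [->|].
Qed.

Lemma move_step e e' : move e e' -> sane e -> exists x, fifo_step M (contents e) x (contents e') /\
  forall c s, c < N -> (chan e c).1 = send_proj c s -> (chan e' c).1 = send_proj c (rcons s x).
Proof.
move=> [c a q' t cN v|c a q' t cN h h'] sn; have [h1 _] := sn _ cN.
  exists (c, true, a); split.
    rewrite contents_setc //; split=> //.
    by rewrite (nth_map 0) ?size_iota // nth_iota //= drop_rcons.
  by move=> j s jN E; rewrite chan_setc // send_proj_rcons andbT [c == j]eq_sym; case: eqP => [<-|];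
   rewrite /= ?E.
exists (c, false, a); split.
  rewrite contents_setc //; split=> //.
  exists (drop (chan e c).2.+1 (chan e c).1); split=> //.
  by rewrite (nth_map 0) ?size_iota // nth_iota //= (drop_nth 0) // h'.
by move=> j s jN E; rewrite chan_setc // send_proj_rcons andbF -E; case: eqP => [->|].
Qed.

(** The completing label word need not be executable, so the channels can be completed
    independently, one after the other, by send actions alone. *)
Lemma in_Pref_viable s : in_Pref_L_bang M As s <->
  forall c, c < N -> viable (aut I c) (send_proj c s).
Proof.
split=> [[t H] c cN|H].
  apply/(viableP (aut_wf cN)); exists (send_proj c t).
  by have := H _ cN; rewrite /send_proj filter_cat map_cat.
suff [t Ht] : exists t, forall c, c < N -> nfa_accepts (aut I c) (send_proj c s ++ send_proj c t).
  by exists t => c /Ht; rewrite /send_proj filter_cat map_cat.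
suff K n : n <= N -> exists t, (forall c, n <= c -> send_proj c t = [::]) /\ forall c, c < n ->
    nfa_accepts (aut I c) (send_proj c s ++ send_proj c t).
  by have [t [_ Ht]] := K N (leqnn _); exists t.
elim: n => [|n IH] nN; first by exists [::].
have [t [t0 Ht]] := IH (ltnW nN).
have /(viableP (aut_wf nN))[v hv] := H _ nN.
exists (t ++ [seq (n, true, a) | a <- v]).
have E c : send_proj c (t ++ [seq (n, true, a) | a <- v]) =
    send_proj c t ++ if c == n then v else [::].
  rewrite /send_proj filter_cat map_cat; congr cat; rewrite filter_map -map_comp.
  rewrite (eq_filter (a2 := fun=> c == n)); last by move=> a /=; rewrite andbT eq_sym.
  by case: (c == n); rewrite ?filter_predT ?filter_pred0 //= map_id.
split=> c cn; rewrite E.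
  by rewrite t0 ?(ltnW cn) // gtn_eqF.
move: cn; rewrite ltnS leq_eqVlt; case: eqP => [-> _|_ /= cn]; first by rewrite t0.
by rewrite cats0; exact: Ht.
Qed.

Lemma contents_start : contents (start I) = init_config M.
Proof.
rewrite /contents /init_config; congr pair.
apply: (@eq_from_nth _ [::]); rewrite size_map size_iota ?size_nseq // => i iN.
by rewrite (nth_map 0) ?size_iota // nth_iota // add0n chan_start // nth_nseq iN.
Qed.

Lemma reachable_Reach e : steps (start I) e -> Reach M As (contents e).
Proof.
move=> st; have sn := reachable_sane st.
suff [s [r E]] : exists s, fifo_run M (init_config M) s (contents e) /\
    forall c, c < N -> (chan e c).1 = send_proj c s.
  exists s; split=> //; apply/in_Pref_viable => c cN; rewrite -E //.
  by case: (sn _ cN).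
elim: st {sn} => [|e' e'' st [s [r E]] m].
  by exists [::]; rewrite contents_start; split; [exact: run_nil|move=> c cN; rewrite chan_start].
have [x [fs H]] := move_step m (reachable_sane st).
exists (rcons s x); split; first exact: fifo_run_rcons r fs.
by move=> c cN; apply: H => //; exact: E.
Qed.

(** Viability passes to prefixes, so every intermediate step of the run is a legal move of
    histories. *)
Lemma Reach_reachable cf : Reach M As cf -> exists2 e, steps (start I) e & contents e = cf.
Proof.
move=> [s [/in_Pref_viable v r]].
suff [e [st E _]] : exists e, [/\ steps (start I) e, contents e = cf &
    forall c, c < N -> (chan e c).1 = send_proj c s] by exists e.
elim/last_ind: s cf v r => [|s x IH] cf v r.
  exists (start I); split; first exact: steps0.
    by rewrite contents_start; inversion r.
  by move=> c cN; rewrite chan_start.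
have [cf' r' fs] := fifo_run_split r.
have v' c : c < N -> viable (aut I c) (send_proj c s).
  move=> cN; have := v _ cN; case: (x) => [[c' b] a]; rewrite send_proj_rcons.
  by case: ifP => // _; rewrite -cats1; exact: (viable_catl (aut_wf cN)).
have [e [st E Es]] := IH _ v' r'; subst cf'.
have xN : x.1.1 < N by case: (x) (cf) fs => [[c b] a] [? ?] [].
have [|e' [m E' Es']] := step_move fs _ (reachable_sane st).
  move=> xs; rewrite Es //; have := v _ xN; move: xs.
  by case: (x) => [[c' b] a] /= ->; rewrite send_proj_rcons eqxx.
exists e'; split=> //; first exact: stepsS st m.
move=> c cN; rewrite Es' // Es //.
by case: (x) => [[c' b] a]; rewrite send_proj_rcons.
Qed.

End Histories.

(** * Pumping *)

Lemma dividesP d n : divides d n = (d %| n).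
Proof.
apply/hasP/dvdnP => [[k _ /eqP <-]|[k E]]; first by exists k.
case: d E => [|d] E; last by exists k; rewrite ?E // mem_iota add0n ltnS leq_pmulr.
by exists 0; rewrite ?mem_iota //= E !muln0.
Qed.

Lemma periodic_fromP d r u : reflect
  (forall i, r <= i -> i + d < size u -> nth 0 u i = nth 0 u (i + d)) (periodic_from d r u).
Proof.
apply: (iffP allP) => H i.
  move=> ri id; have /H : i \in iota 0 (size u) by rewrite mem_iota; lia.
  by rewrite ltnNge ri leqNgt id /= => /eqP.
move=> _; case: ltnP => //= ri; case: leqP => //= id; apply/eqP; exact: H.
Qed.

Lemma periodic_from_mod d r u k : 0 < d -> periodic_from d r u -> r <= k -> k < size u ->
  nth 0 u k = nth 0 u (r + (k - r) %% d).
Proof.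
move=> d0 /periodic_fromP H; have [n] := ubnP k; elim: n k => // n IH k kn rk ku.
have [lt|ge] := ltnP (k - r) d; first by rewrite modn_small // subnKC.
have E : k = (k - d) + d by lia.
rewrite [in LHS]E -H; [|lia|lia]. rewrite IH; [|lia|lia|lia].
congr nth; congr addn; rewrite -(modnDr (k - d - r)); congr modn; lia.
Qed.

(** Here [a], [a'] count letters sent and [b], [b'] letters received at the two ends of a loop. *)
Lemma sub_growth a a' b b' m n : a <= a' -> b <= b' -> b <= a -> b' <= a' ->
  a - b <= a' - b' -> a' - a = m -> b' - b = n -> a' - b' = a - b + (m - n).
Proof. lia. Qed.

Section Pumping.
Variables (M : fifo) (As : seq nfa).
Hypothesis wfM : instance_wf M As.
Hypothesis prM : instance_promise M As.
Let I : inst := (M, As).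
Let N := nch M.

Lemma move_chan_mono e e' c : c < N -> move M As e e' ->
  prefix (chan e c).1 (chan e' c).1 /\ (chan e c).2 <= (chan e' c).2.
Proof.
move=> cN [j a q' t jN v|j a q' t jN h h']; rewrite chan_setc //.
  by case: eqP => [->|_]; split; rewrite ?prefix_refl //= -cats1 prefix_prefix.
by case: eqP => [->|_]; split; rewrite ?prefix_refl.
Qed.

Lemma steps_chan_mono e e' c : c < N -> steps M As e e' ->
  prefix (chan e c).1 (chan e' c).1 /\ (chan e c).2 <= (chan e' c).2.
Proof.
move=> cN; elim=> [|x y _ [p1 r1] m]; first by rewrite prefix_refl.
have [p2 r2] := move_chan_mono cN m.
by split; [exact: prefix_trans p1 p2|exact: leq_trans r1 r2].
Qed.

Lemma prefix_nth (u v : seq nat) k : prefix u v -> k < size u -> nth 0 u k = nth 0 v k.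
Proof. by move=> /prefixP[w ->] h; rewrite nth_cat h. Qed.

(* Channel [c] of [g] can do whatever it does along the loop from [e] to [e'] when at [x]:
   nothing is received on it, or both contents are factors, starting at the same
   phase, of one [d]-periodic word, and [g] is longer by a multiple of [d]. *)
Definition dominates (e e' : hist) c (g x : seq nat * nat) :=
  [/\ dst (aut I c) g.1 = dst (aut I c) x.1, g.2 <= size g.1 &
   (chan e c).2 = (chan e' c).2 \/
   exists d, [/\ [&& 0 < d, d %| size (chan e' c).1 - size (chan e c).1,
                  d %| (chan e' c).2 - (chan e c).2 &
                  periodic_from d (chan e c).2 (chan e' c).1],
    size x.1 - x.2 <= size g.1 - g.2,
    size g.1 - g.2 = size x.1 - x.2 %[mod d] &
    forall j, j < size g.1 - g.2 ->
      nth 0 g.1 (g.2 + j) = nth 0 (chan e' c).1 ((chan e c).2 + (x.2 - (chan e c).2 + j) %% d)]].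

Definition simulates e e' g x :=
  g.1 = x.1 /\ forall c, c < N -> dominates e e' c (chan g c) (chan x c).

(** Viability of a send depends only on the subset state, and the letter sent continues the periodic
    word of [g] because the lengths agree modulo [d]. For a receive, [g] is no shorter than [x] and
    has the same phase, hence the same head. Reaching [e'] later places all letters involved in the
    word sent at [e']. *)
Lemma simulate_move e e' g x y : sane M As e -> steps M As e x -> move M As x y ->
  steps M As y e' -> simulates e e' g x ->
  exists g', [/\ move M As g g', simulates e e' g' y &
    forall c, c < N -> len g' c + len x c = len g c + len y c].
Proof.
move=> sn ex m ye' [gq G]; have ey := stepsS ex m.
have sx := sane_steps sn ex.
case: m ye' ey => [c a q' t cN v|c a q' t cN h h'] ye' ey.
  have [D1 D2 D3] := G _ cN; have [x1 _] := sx _ cN.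
  have [y1 y2] := steps_chan_mono cN ye'; have [e1 e2] := steps_chan_mono cN ex.
  move: y1 y2; rewrite chan_setc // eqxx /= => y1 y2.
  exists (q', setc N g c (rcons (chan g c).1 a, (chan g c).2)); split.
  - apply: (MSend (a := a)) => //; first by rewrite gq.
    by move: v; rewrite /viable !(dst_rcons _ _) D1.
  - split=> // j jN; rewrite !chan_setc //; case: eqP => [E|_]; last exact: G.
    subst j.
    split; rewrite /= ?size_rcons ?dst_rcons ?D1 //; first exact: leqW.
    case: D3 => [->|[d [P l md D3]]]; [by left|right; exists d; split=> //].
    + lia.
    + by rewrite !subSn // -[_.+1]addn1 -[(_ - _).+1]addn1 -modnDml md modnDml.
    move=> i; rewrite subSn // ltnS leq_eqVlt => /predU1P[->|lt]; last first.
      by rewrite nth_rcons ifT ?D3 //; lia.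
    case/and4P: P => d0 _ _ per.
    (* The letter just sent is found in the word of [e'], whose periodicity is known. *)
    have Ea : a = nth 0 (chan e' c).1 (size (chan x c).1).
      by rewrite -(prefix_nth y1) ?size_rcons // nth_rcons ltnn eqxx.
    have le : size (chan x c).1 < size (chan e' c).1.
      by have := size_prefix y1; rewrite size_rcons.
    rewrite subnKC // nth_rcons ltnn eqxx Ea (periodic_from_mod d0 per) //; last lia.
    congr nth; congr addn; rewrite -modnDmr md modnDmr; congr modn; lia.
  - move=> j jN; rewrite /len !chan_setc //; case: eqP => [->|_] //=.
    rewrite !size_rcons; lia.
have [D1 D2 D3] := G _ cN; have [x1 _] := sx _ cN.
have [y1 y2] := steps_chan_mono cN ye'; have [e1 e2] := steps_chan_mono cN ex.
move: y1 y2; rewrite chan_setc // eqxx /= => y1 y2.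
(* A receive on [c] contradicts equal received counts at both ends of the loop. *)
case: D3 => [E|[d [P l md D3]]]; first lia.
case/and4P: (P) => d0 _ _ per.
have gl : (chan g c).2 < size (chan g c).1 by lia.
exists (q', setc N g c ((chan g c).1, (chan g c).2.+1)); split.
- rewrite -gq in t; apply: (MRecv As t) => //.
  rewrite -[X in nth _ _ X]addn0 D3; last lia.
  rewrite addn0 -(periodic_from_mod d0 per) //; last exact: leq_trans h (size_prefix y1).
  by rewrite -(prefix_nth y1).
- split=> // j jN; rewrite !chan_setc //; case: eqP => [E|_]; last exact: G.
  subst j; split=> //=; right; exists d; split=> //.
  + lia.
  + apply/eqP; rewrite -(eqn_modDr 1) !addn1 -!subSn // !subSS; exact/eqP.
  move=> i lt; rewrite addSnnS D3; last lia.
  congr nth; congr addn; congr modn; lia.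
- move=> j jN; rewrite /len !chan_setc //; case: eqP => [->|_] //=.
  lia.
Qed.

Lemma simulate_steps e e' g x : sane M As e -> simulates e e' g e -> steps M As e x ->
  steps M As x e' ->
  exists g', [/\ steps M As g g', simulates e e' g' x &
    forall c, c < N -> len g' c + len e c = len g c + len x c].
Proof.
move=> sn G; elim=> [|y z ey IH m] xe'.
  by exists g; split=> //; exact: steps0.
have ye' : steps M As y e' by apply: steps_trans xe'; apply: stepsS m; exact: steps0.
have [g1 [gg1 S1 L1]] := IH ye'.
have [g2 [m2 S2 L2]] := simulate_move sn ey m xe' S1.
exists g2; split=> //; first exact: stepsS gg1 m2.
by move=> c cN; have := L1 _ cN; have := L2 _ cN; lia.
Qed.

(** Starting from [e], the loop is replayed any number of times, each turn lengthening channel [c0],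
    while a finite list of configurations bounds the length of its content. *)
Lemma pump_infinite e e' : steps M As (start I) e -> steps M As e e' -> pump I e e' ->
  Reach_infinite M As.
Proof.
move=> se ee' /and3P[/eqP qE /allP P /hasP[c0 c0N lt]] [l Hl].
have c0N' : c0 < N by move: c0N; rewrite mem_iota.
have sn := reachable_sane wfM prM se.
have sn' := sane_steps sn ee'.
have P' c : c < N -> [/\ dst (aut I c) (chan e c).1 = dst (aut I c) (chan e' c).1,
    len e c <= len e' c & steady e e' c].
  by move=> cN; have /P/and3P[/eqP] : c \in iota 0 N by rewrite mem_iota.
(* At the end of a turn the role of [e'] is handed back to [e]: subset states agree, [e] is no
   longer than [e'], and lengths and phases differ by multiples of [d]. *)
have back g : simulates e e' g e' -> simulates e e' g e.
  move=> [gq G]; split; first by rewrite gq.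
  move=> c cN; have [D1 D2 D3] := G _ cN; have [dE ll _] := P' _ cN.
  have [s1 _] := sn _ cN; have [s2 _] := sn' _ cN.
  have [p1 p2] := steps_chan_mono cN ee'; have p3 := size_prefix p1.
  split; [by rewrite D1|by []|].
  case: D3 => [->|[d [Q l1 md D3]]]; [by left|right; exists d].
  case/and4P: (Q) => d0 /dvdnP[k1 E1] /dvdnP[k2 E2] per.
  rewrite /len in ll; split=> //; first lia.
    rewrite md; rewrite (sub_growth p3 p2 s1 s2 ll E1 E2) -mulnBl addnC; exact: modnMDl.
  move=> j jl; rewrite D3 // subnn add0n E2; by rewrite modnMDl.
have init : simulates e e' e e.
  split=> // c cN; have [s1 _] := sn _ cN; have [_ ll] := P' _ cN.
  have [p1 p2] := steps_chan_mono cN ee'; have p3 := size_prefix p1.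
  move=> /orP[/eqP rE|]; first by split=> //; left.
  move=> /hasP[d _]; rewrite !dividesP => /and4P[d0 d1 d2 per].
  split=> //; right; exists d; split=> //; first exact/and4P.
  move=> j jl; rewrite (prefix_nth p1); last lia.
  rewrite (periodic_from_mod d0 per) ?leq_addr //; last by apply: leq_trans p3; rewrite -ltn_subRL.
  by rewrite addKn subnn add0n.
have grow K : exists g, [/\ steps M As (start I) g, simulates e e' g e & K <= len g c0].
  elim: K => [|K [g [sg G Kg]]]; first by exists e.
  have [g' [gg' G' L]] := simulate_steps sn G ee' (steps0 _ _ _).
  exists g'; split; [exact: steps_trans sg gg'|exact: back|].
  by have := L _ c0N'; lia.
pose K := (\max_(cf <- l) size (nth [::] cf.2 c0)).+1.
have [g [sg _]] := grow K.
have /Hl mem := reachable_Reach wfM prM sg.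
rewrite -(size_contents g c0N') // /K.
have := @leq_bigmax_seq _ l predT (fun cf : config => size (nth [::] cf.2 c0)) _ mem isT.
by rewrite leqNgt => /negP.
Qed.

End Pumping.

(** * Runs without repeated keys *)

Lemma bounded_witnesses (T : eqType) (l : seq T) (Q : T -> nat -> Prop) :
  (forall x, x \in l -> exists k, Q x k) ->
  exists K, forall x, x \in l -> exists2 k, k <= K & Q x k.
Proof.
elim: l => [|x l IH] H; first by exists 0.
have [|K HK] := IH; first by move=> y yl; apply: H; rewrite inE yl orbT.
have [|k hk] := H x; first by rewrite inE eqxx.
exists (maxn k K) => y; rewrite inE => /orP[/eqP->|/HK[j jK hj]].
  by exists k => //; exact: leq_maxl.
by exists j => //; apply: leq_trans jK (leq_maxr _ _).
Qed.

(** Levels are finite lists, so a node with descendants at all later levels has a child of the same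
    kind; such children are chosen repeatedly. *)
Lemma koenig (T : eqType) (lev : nat -> seq (seq T)) (root : T) :
  lev 0 = [:: [:: root]] ->
  (forall n t, t \in lev n.+1 -> exists e t0, t = e :: t0 /\ t0 \in lev n) ->
  (forall n, lev n <> [::]) ->
  exists t : nat -> seq T, t 0 = [:: root] /\
    forall n, t n \in lev n /\ exists e, t n.+1 = e :: t n.
Proof.
move=> lev0 levS ne.
(* Nodes grow at the head, so [drop j] yields the ancestor [j] generations up. *)
have drop_lev j k t : t \in lev (j + k) -> drop j t \in lev k.
  elim: j t => [|j IH] t; first by rewrite drop0.
  by move=> /levS[e [t0 [-> h]]]; exact: IH.
pose P n t := t \in lev n /\ forall k, n <= k -> exists2 t', t' \in lev k & drop (k - n) t' = t.
have PS n t : P n t -> exists t', P n.+1 t' /\ exists e, t' = e :: t.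
  move=> [h H]; apply: NNPP => no.
  (* If no child is suitable, each is without descendants at some level, and [K] bounds these
     levels. A descendant of [t] at level [maxn K n.+1] passes through one of the children, a
     contradiction. *)
  have [|K HK] := @bounded_witnesses _ [seq x <- lev n.+1 | behead x == t]
    (fun x k => n < k /\ forall t', t' \in lev k -> drop (k - n.+1) t' <> x).
    move=> x; rewrite mem_filter => /andP[/eqP xt xl]; apply: NNPP => nk; apply: no.
    exists x; split; last by have [e [t0 [E _]]] := levS _ _ xl; exists e; rewrite -xt E.
    split=> // k nk'; apply: NNPP => nt; apply: nk; exists k; split=> // t' ht' E.
    by apply: nt; exists t'.
  have [|t2 ht2 E2] := H (maxn K n.+1); first by rewrite leq_max leqnSn orbT.
  have [|k kK [nk]] := HK (drop (maxn K n.+1 - n.+1) t2).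
    rewrite mem_filter; apply/andP; split; last by apply: drop_lev; rewrite subnK // leq_maxr.
    by rewrite -drop1 drop_drop add1n subnSK ?E2 // leq_max ltnSn orbT.
  move=> /(_ (drop (maxn K n.+1 - k) t2)); apply.
    by apply: drop_lev; rewrite subnK // leq_max kK.
  by rewrite drop_drop; congr drop; lia.
have P0 : P 0 [:: root].
  split; first by rewrite lev0 inE.
  move=> k _; case E: (lev k) (ne k) => [|t l] // _; exists t; first by rewrite inE eqxx.
  have : drop k t \in lev 0 by apply: drop_lev; rewrite addn0 E inE eqxx.
  by rewrite lev0 inE subn0 => /eqP.
pose next (s : {p : nat * seq T | P p.1 p.2}) : {p : nat * seq T | P p.1 p.2} :=
  let x := constructive_indefinite_description _ (PS _ _ (svalP s)) in
  exist (fun p : nat * seq T => P p.1 p.2) ((sval s).1.+1, sval x) (proj1 (svalP x)).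
pose sq n := iter n next (exist (fun p : nat * seq T => P p.1 p.2) (0, [:: root]) P0).
have sq1 n : (sval (sq n)).1 = n by elim: n => //= n ->.
exists (fun n => (sval (sq n)).2); split=> // n; split.
  by have [] := svalP (sq n); rewrite sq1.
exact: proj2 (svalP (constructive_indefinite_description _ (PS _ _ (svalP (sq n))))).
Qed.

Section Traces.
Variables (M : fifo) (As : seq nfa).
Hypothesis wfM : instance_wf M As.
Hypothesis prM : instance_promise M As.
Let I : inst := (M, As).
Let N := nch M.

Lemma levelS n tr : tr \in level I n.+1 <-> exists tr0 e,
  [/\ tr = e :: tr0, tr0 \in level I n, move M As (head (start I) tr0) e &
      key I e \notin [seq key I e' | e' <- tr0]].
Proof.
split.
  move=> /flattenP[s /mapP[tr0 h ->] /mapP[e]]; rewrite mem_filter => /andP[h1 h2] ->.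
  by exists tr0, e; split=> //; apply/(succsP wfM).
move=> [tr0 [e [-> h /(succsP wfM) h1 h2]]].
apply/flattenP; exists (extend I tr0); first exact: map_f.
by apply/mapP; exists e => //; rewrite mem_filter h2.
Qed.

Lemma level_suffix n tr e : tr \in level I n -> e \in tr ->
  exists m tr', tr' \in level I m /\ head (start I) tr' = e.
Proof.
elim: n tr => [|n IH] tr.
  by rewrite inE => /eqP->; rewrite inE => /eqP->; exists 0, [:: start I]; rewrite inE.
move=> h; have /levelS[tr0 [e0 [E h0 _ _]]] := h; rewrite {1}E inE => /orP[/eqP->|]; last exact: IH.
by exists n.+1, tr; rewrite h E.
Qed.

Lemma level_steps n tr e : tr \in level I n -> e \in tr ->
  steps M As (start I) e /\ steps M As e (head (start I) tr).
Proof.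
elim: n tr e => [|n IH] tr e.
  by rewrite inE => /eqP->; rewrite inE => /eqP->; split; exact: steps0.
move=> /levelS[tr0 [e0 [-> h0 m _]]].
have hd : head (start I) tr0 \in tr0.
  case: n {IH} h0 => [|n]; first by rewrite inE => /eqP->; rewrite inE.
  by move=> /levelS[t1 [e1 [-> _ _ _]]]; rewrite inE eqxx.
rewrite inE => /orP[/eqP->|he].
  by split; [apply: stepsS m; case: (IH _ _ h0 hd)|exact: steps0].
by have [h1 h2]  := IH _ _ h0 he; split=> //; exact: stepsS h2 m.
Qed.

Lemma key_chan e x c : c < N -> key I e = key I x ->
  drop (chan e c).2 (chan e c).1 = drop (chan x c).2 (chan x c).1 /\
  dst (aut I c) (chan e c).1 = dst (aut I c) (chan x c).1.
Proof.
move=> cN [_ /eq_in_map /(_ c)]; rewrite mem_iota /= add0n => /(_ cN) [].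
by [].
Qed.

Lemma key_setc q e c ch q' x ch' : c < N -> key I e = key I x -> q = q' ->
  drop ch.2 ch.1 = drop ch'.2 ch'.1 -> dst (aut I c) ch.1 = dst (aut I c) ch'.1 ->
  key I (q, setc N e c ch) = key I (q', setc N x c ch').
Proof.
move=> cN K -> E1 E2; congr pair; apply/eq_in_map => j.
rewrite mem_iota add0n => /andP[_ jN]; rewrite !chan_setc //.
case: eqP => [->|_]; first by rewrite E1 E2.
by have [-> ->] := key_chan jN K.
Qed.

(** Equality of keys is a bisimulation: enabled moves and the keys they lead to depend on the key
    alone. *)
Lemma key_move e x e' : sane M As e -> sane M As x -> key I e = key I x -> move M As e e' ->
  exists2 x', move M As x x' & key I x' = key I e'.
Proof.
move=> se sx K m; have q : e.1 = x.1 by case: K.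
case: m => [c a q' t cN v|c a q' t cN h h']; have [E1 E2] := key_chan cN K;
  have [s1 _] := se _ cN; have [s2 _] := sx _ cN.
  rewrite q in t; exists (q', setc N x c (rcons (chan x c).1 a, (chan x c).2)).
    by apply: MSend t cN _; move: v; rewrite /viable !dst_rcons E2.
  apply: key_setc => //=; last by rewrite !dst_rcons E2.
  by rewrite !drop_rcons // E1.
rewrite q in t.
have lt : (chan x c).2 < size (chan x c).1 by rewrite -subn_gt0 -size_drop -E1 size_drop subn_gt0.
exists (q', setc N x c ((chan x c).1, (chan x c).2.+1)).
  apply: MRecv t cN lt _.
  by rewrite -h' -[X in nth _ _ X]addn0 -nth_drop -E1 nth_drop addn0.
apply: key_setc => //=; first by rewrite -add1n -drop_drop -E1 drop_drop.
Qed.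

(** Follow the run up to keys: when the next key already occurs on the trace nothing is added,
    otherwise the trace, cut back to the current history, is extended. *)
Lemma reachable_traced e : steps M As (start I) e ->
  exists n tr, tr \in level I n /\ key I e \in [seq key I x | x <- tr].
Proof.
move=> st; elim: st => [|e' e'' st [n [tr [h /mapP[x hx K]]]] m].
  by exists 0, [:: start I]; rewrite inE eqxx /= inE.
have [s1 _] := level_steps h hx.
have [x' m' K'] := key_move (reachable_sane wfM prM st) (reachable_sane wfM prM s1) K m.
have [k [tr' [h' hd]]] := level_suffix h hx.
have [tm|tn] := boolP (key I x' \in [seq key I y | y <- tr']).
  by exists k, tr'; rewrite -K'.
exists k.+1, (x' :: tr'); split; last by rewrite -K' inE eqxx.
by apply/levelS; exists tr', x'; split=> //; rewrite hd.
Qed.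

(** All levels from [n] on are empty, so every reachable key lies on one of finitely many shorter
    traces, and the configuration is a function of the key. *)
Lemma level_nil_finite n : level I n = [::] -> ~ Reach_infinite M As.
Proof.
move=> E; apply.
pose ks := flatten [seq flatten [seq [seq key I x | x <- tr] | tr <- level I m] | m <- iota 0 n].
exists [seq (k.1, [seq p.1 | p <- k.2]) | k <- ks] => cf /(Reach_reachable wfM prM)[e st <-].
have -> : contents M e = ((key I e).1, [seq p.1 | p <- (key I e).2]).
  by rewrite /key /contents -map_comp.
apply: map_f; have [m [tr [h hk]]] := reachable_traced st.
have nil k : level I (k + n) = [::] by elim: k => //= k ->.
have mn : m < n.
  by rewrite ltnNge; apply/negP => /subnK mn; move: h; rewrite -mn nil.
apply/flattenP; exists (flatten [seq [seq key I x | x <- tr] | tr <- level I m]).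
  by apply: map_f; rewrite mem_iota.
by apply/flattenP; exists [seq key I x | x <- tr] => //; exact: map_f.
Qed.

Lemma pumpable_infinite n tr : tr \in level I n -> pumpable I tr -> Reach_infinite M As.
Proof.
move=> h /hasP[e he p]; have [h1 h2] := level_steps h he.
exact: (pump_infinite wfM prM h1 h2 p).
Qed.

Lemma infinite_trace : (forall n, level I n <> [::]) ->
  exists t : nat -> seq hist, t 0 = [:: start I] /\
    forall n, t n \in level I n /\ exists e, t n.+1 = e :: t n.
Proof.
apply: koenig => // n tr /levelS[tr0 [e [-> h _ _]]]; by exists e, tr0.
Qed.

End Traces.

(** * Completeness of pumping *)

Definition increasing (phi : nat -> nat) := forall i j, i < j -> phi i < phi j.

(** Every infinite set of indices contains an infinite one on which [R] holds for all pairs in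
    order. Quantifying over [psi] makes this stable under conjunction, which yields Dickson's
    lemma. *)
Definition chainable (R : nat -> nat -> Prop) := forall psi, increasing psi ->
  exists2 phi, increasing phi & forall i j, i < j -> R (psi (phi i)) (psi (phi j)).

Lemma increasing_comp f g : increasing f -> increasing g -> increasing (f \o g).
Proof. by move=> F G i j /G /F. Qed.

Lemma increasing_step f : (forall i, f i < f i.+1) -> increasing f.
Proof.
move=> H i j; elim: j => // j IH; rewrite ltnS leq_eqVlt => /orP[/eqP->|/IH h] //.
exact: ltn_trans h (H j).
Qed.

Lemma chainable_and R S : chainable R -> chainable S -> chainable (fun i j => R i j /\ S i j).
Proof.
move=> cR cS psi ip; have [f fi fR] := cR _ ip.
have [g gi gS] := cS _ (increasing_comp ip fi).
exists (f \o g); first exact: increasing_comp.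
by move=> i j ij; split; [apply: fR; exact: gi|exact: gS].
Qed.

Lemma chainable_sub (R S : nat -> nat -> Prop) :
  (forall i j, i < j -> R i j -> S i j) -> chainable R -> chainable S.
Proof.
move=> H cR psi ip; have [f fi fR] := cR _ ip; exists f => // i j ij.
by apply: H; [apply: ip; exact: fi|exact: fR].
Qed.

Lemma chainable_all n (R : nat -> nat -> nat -> Prop) : (forall c, c < n -> chainable (R c)) ->
  chainable (fun i j => forall c, c < n -> R c i j).
Proof.
elim: n => [|n IH] H; first by move=> psi _; exists id.
have h1 := IH (fun c cn => H c (ltnW cn)).
apply: chainable_sub (chainable_and h1 (H n (leqnn _))) => i j _ [h2 h3] c.
by rewrite ltnS leq_eqVlt => /orP[/eqP->|/h2].
Qed.

Lemma tail_min (f : nat -> nat) m : exists2 i, m <= i & forall j, m <= j -> f i <= f j.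
Proof.
suff H v : (exists2 j, m <= j & f j <= v) -> exists2 i, m <= i & forall j, m <= j -> f i <= f j.
  by apply: (H (f m)); exists m.
elim: v => [|v IH] [j mj fj]; first by exists j => // k _; lia.
have [h|h] := classic (exists2 j, m <= j & f j <= v); first exact: IH.
exists j => // k mk; apply: leq_trans fj _; rewrite ltnNge; apply/negP => fk.
by apply: h; exists k.
Qed.

(** The subsequence picks successive minima of the tails. *)
Lemma chainable_leq (f : nat -> nat) : chainable (fun i j => f i <= f j).
Proof.
move=> psi _; pose g i := f (psi i).
have H m : exists i, m <= i /\ forall j, m <= j -> g i <= g j.
  by have [i h1 h2] := tail_min g m; exists i.
pose nxt m := sval (constructive_indefinite_description _ (H m)).
have nxtP m : m <= nxt m /\ forall j, m <= j -> g (nxt m) <= g j.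
  by rewrite /nxt; case: constructive_indefinite_description.
pose phi n := iter n (fun p => nxt p.+1) (nxt 0).
have inc : increasing phi by apply: increasing_step => i; have [] := nxtP (phi i).+1.
exists phi => // i j ij; apply: (_ : g (phi i) <= g (phi j)).
case: i ij => [|i] ij; first by have [_ ->] := nxtP 0.
have [_] := nxtP (phi i).+1; apply.
by apply: inc; exact: ltn_trans ij.
Qed.

(** Along a common subsequence both [f] and [B - f] are nondecreasing, hence [f] is constant. *)
Lemma chainable_eq (f : nat -> nat) B : (forall i, f i <= B) -> chainable (fun i j => f i = f j).
Proof.
move=> fB.
apply: chainable_sub (chainable_and (chainable_leq f) (chainable_leq (fun i => B - f i))).
by move=> i j _ [h1 h2]; have := fB i; have := fB j; lia.
Qed.

(** * Infinite words with all prefixes in those of a bounded expression *)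

Lemma bounded_expr_cons w ws x : in_bounded_expr (w :: ws) x ->
  exists k y, x = flatten (nseq k w) ++ y /\ in_bounded_expr ws y.
Proof.
case=> -[|k ks] [] //= [sz] ->.
by exists k, (flatten [seq flatten (nseq p.2 p.1) | p <- zip ws ks]); split=> //; exists ks.
Qed.

Lemma size_pow (w : seq nat) k : size (flatten (nseq k w)) = k * size w.
Proof. by elim: k => //= k IH; rewrite size_cat IH mulSn. Qed.

Lemma nth_pow (w : seq nat) k i : i < k * size w ->
  nth 0 (flatten (nseq k w)) i = nth 0 w (i %% size w).
Proof.
elim: k i => // k IH i; rewrite mulSn /= nth_cat => h.
case: ltnP => hi; first by rewrite modn_small.
by rewrite IH; [rewrite -[in RHS](subnK hi) modnDr|lia].
Qed.

(** Either [f] is the infinite power of [w], or its first differences from it bound the exponent of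
    [w] in all long decompositions. One exponent [n] then serves for every length, and the rest of
    [f] is treated by induction. *)
Lemma ultimately_periodic (ws : seq (seq nat)) (f : nat -> nat) :
  all (fun w => w != [::]) ws ->
  (forall m, exists v, in_bounded_expr ws (mkseq f m ++ v)) ->
  exists K d, 0 < d /\ forall k, K <= k -> f (k + d) = f k.
Proof.
elim: ws f => [|w ws IH] f.
  (* The empty expression contains only the empty word, so it has no prefix of length 1. *)
  by move=> _ /(_ 1)[v [[|k ks] [_]]].
move=> /= /andP[w0 wss] H.
have sw : 0 < size w by rewrite lt0n size_eq0.
have [per|nper] := classic (forall k, f k = nth 0 w (k %% size w)).
  by exists 0, (size w); split=> // k _; rewrite !per modnDr.
have [k0 fk0] : exists k, f k <> nth 0 w (k %% size w) by exact: not_all_ex_not.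
suff [n Hn] : exists n, forall m, exists v,
    in_bounded_expr ws (mkseq (fun k => f (n * size w + k)) m ++ v).
  have [K [d [d0 Kd]]] := IH _ wss Hn; exists (n * size w + K), d; split=> // k kK.
  have -> : k = n * size w + (k - n * size w) by lia.
  by rewrite -addnA Kd //; lia.
apply: NNPP => no.
(* Otherwise every exponent up to [k0] fails at some length, and [B] bounds these lengths. *)
have [|B HB] := @bounded_witnesses _ (iota 0 k0.+1) (fun n m =>
    forall v, ~ in_bounded_expr ws (mkseq (fun k => f (n * size w + k)) m ++ v)).
  move=> n _; apply: NNPP => nm; apply: no; exists n => m; apply: NNPP => nv.
  by apply: nm; exists m => v hv; apply: nv; exists v.
(* This length covers the mismatch at [k0] and leaves at least [B] letters after removing up to [k0]
   copies of [w]. *)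
have [v /bounded_expr_cons[n [y [E Ey]]]] := H (k0.+1 + k0 * size w + B).
set m0 := k0.+1 + k0 * size w + B in E.
have nth_l i : i < m0 -> nth 0 (mkseq f m0 ++ v) i = f i.
  by move=> im; rewrite nth_cat size_mkseq im nth_mkseq.
have nk : n * size w <= k0.
  rewrite leqNgt; apply/negP => lt; apply: fk0.
  rewrite -nth_l; last by rewrite /m0; lia.
  by rewrite E nth_cat size_pow lt nth_pow.
have nk' : n <= k0 by apply: leq_trans nk; rewrite leq_pmulr.
have [|m mB] := HB n; first by rewrite mem_iota.
have dE : y = drop (n * size w) (mkseq f m0 ++ v).
  by rewrite E drop_size_cat // size_pow.
have ys : n * size w + m <= m0 by rewrite /m0; lia.
move=> /(_ (drop m y)); apply.
suff -> : mkseq (fun k => f (n * size w + k)) m = take m y by rewrite cat_take_drop.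
have szy : m <= size y by rewrite dE size_drop size_cat size_mkseq; lia.
apply: (@eq_from_nth _ 0); first by rewrite size_mkseq size_takel.
move=> i; rewrite size_mkseq => im; rewrite nth_mkseq // nth_take // dE nth_drop nth_l //; lia.
Qed.

Lemma bounded_mono_constant (r : nat -> nat) K : (forall i j, i <= j -> r i <= r j) ->
  (forall i, r i <= K) -> exists t, forall i, t <= i -> r i = r t.
Proof.
move=> mono; elim: K => [|K IH] H; first by exists 0 => i _; have := H i; have := H 0; lia.
have [[t ht]|no] := classic (exists t, r t = K.+1).
  by exists t => i ti; have := mono _ _ ti; have := H i; lia.
apply: IH => i; have := H i; rewrite leq_eqVlt => /orP[/eqP E|//].
by case: no; exists i.
Qed.

(** * Pumpable pairs on an infinite run *)

Section Completeness.
Variables (M : fifo) (As : seq nfa).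
Hypothesis wfM : instance_wf M As.
Hypothesis prM : instance_promise M As.
Let I : inst := (M, As).
Let N := nch M.

Variable e : nat -> hist.
Hypothesis e_start : forall i, steps M As (start I) (e i).
Hypothesis e_steps : forall i j, i <= j -> steps M As (e i) (e j).

Let u c i := (chan (e i) c).1.
Let r c i := (chan (e i) c).2.

Lemma sent_prefix c i j : c < N -> i <= j -> prefix (u c i) (u c j).
Proof. by move=> cN /e_steps/(steps_chan_mono cN)[]. Qed.

Lemma received_mono c i j : c < N -> i <= j -> r c i <= r c j.
Proof. by move=> cN /e_steps/(steps_chan_mono cN)[]. Qed.

Lemma received_sent c i : c < N -> r c i <= size (u c i).
Proof. by move=> cN; case: (reachable_sane wfM prM (e_start i) cN). Qed.

(** When receptions have stopped, [d] is any positive number; it only serves as a modulus later. *)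
Definition settled c t := exists2 d, 0 < d &
  (forall i, t <= i -> r c i = r c t) \/
  (forall i j, t <= i -> periodic_from d (r c i) (u c j)).

Lemma settled_later c t t' : t <= t' -> settled c t -> settled c t'.
Proof.
move=> tt [d d0 [H|H]]; exists d => //; [left|right].
  by move=> i ti; rewrite !H //; exact: leq_trans ti.
by move=> i j ti; apply: H; exact: leq_trans ti.
Qed.

(** A bounded received count is eventually constant. Otherwise the words sent converge to an
    ultimately periodic word, and the read position finally passes its preperiod. *)
Lemma settles c : c < N -> exists t, settled c t.
Proof.
move=> cN.
have [[K HK]|unb] := classic (exists K, forall i, r c i <= K).
  have [t Ht] := bounded_mono_constant (fun i j => @received_mono c i j cN) HK.
  by exists t, 1 => //; left.
have unb' K : exists i, K < r c i.
  apply: NNPP => no; apply: unb; exists K => i; rewrite leqNgt; apply/negP => h.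
  by apply: no; exists i.
have long K : exists i, K < size (u c i).
  by have [i h] := unb' K; exists i; apply: leq_trans h (received_sent i cN).
(* The limit word [f] is read at any index where the word sent is long enough; the choice is
   immaterial by the prefix order. *)
pose idx k := sval (constructive_indefinite_description _ (long k)).
have idxP k : k < size (u c (idx k)).
  by rewrite /idx; case: constructive_indefinite_description.
pose f k := nth 0 (u c (idx k)) k.
have fE j k : k < size (u c j) -> nth 0 (u c j) k = f k.
  move=> h; rewrite /f; have [ij|ji] := leqP (idx k) j.
    by rewrite -(prefix_nth (sent_prefix cN ij)).
  by rewrite -(prefix_nth (sent_prefix cN (ltnW ji))).
have [_ [ws [/allP wsP Hws]]] := prM cN.
have [||K [d [d0 Kd]]] := @ultimately_periodic ws f.
- by apply/allP => w /wsP /andP[].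
- move=> m; have [j hj] := long m.
  have [_ /(viableP (aut_wf wfM cN))[v /Hws hv]] := reachable_sane wfM prM (e_start j) cN.
  exists (drop m (u c j) ++ v); suff -> : mkseq f m = take m (u c j) by rewrite catA cat_take_drop.
  apply: (@eq_from_nth _ 0); first by rewrite size_mkseq size_takel // ltnW.
  move=> i; rewrite size_mkseq => im; rewrite nth_mkseq // nth_take // fE //; exact: ltn_trans hj.
have [t ht] := unb' K; exists t, d => //; right=> i j ti.
apply/periodic_fromP => k ri kd; rewrite !fE //; last by apply: leq_ltn_trans kd; exact: leq_addr.
rewrite Kd //; apply: leq_trans ri; apply: ltnW; apply: leq_trans ht _; exact: received_mono.
Qed.

(** The last clause turns distinctness of keys into a strict increase of some length. *)
Definition repeats c i j :=
  [/\ dst (aut I c) (u c i) = dst (aut I c) (u c j), len (e i) c <= len (e j) c,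
      steady (e i) (e j) c &
      len (e i) c = len (e j) c -> drop (r c i) (u c i) = drop (r c j) (u c j)].

Lemma chainable_dst c : c < N ->
  chainable (fun i j => dst (aut I c) (u c i) = dst (aut I c) (u c j)).
Proof.
move=> cN; apply: chainable_sub (chainable_all (n := nfa_n (aut I c))
  (R := fun p i j => (p \in dst (aut I c) (u c i) : nat) = (p \in dst (aut I c) (u c j))) _).
  by move=> i j _ H; apply: dst_eq => p /H; do 2 case: (_ \in _).
by move=> p _; apply: (@chainable_eq _ 1) => i; exact: leq_b1.
Qed.

Lemma chainable_repeats c t : c < N -> settled c t ->
  chainable (fun i j => repeats c (t + i) (t + j)).
Proof.
move=> cN [d d0 D].
have shift R : chainable R -> chainable (fun i j => R (t + i) (t + j)).
  move=> cR psi ip; apply: (cR (fun i => t + psi i)) => i j ij.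
  by rewrite ltn_add2l; exact: ip.
pose S i j := [/\ dst (aut I c) (u c i) = dst (aut I c) (u c j), len (e i) c <= len (e j) c,
  (* Congruent received and sent counts give equal phases and make the loop cover whole periods. *)
  r c i %% d = r c j %% d & size (u c i) %% d = size (u c j) %% d].
have cS : chainable S.
  have c1 := chainable_and (chainable_dst cN) (chainable_leq (fun i => len (e i) c)).
  have c2 : chainable (fun i j => r c i %% d = r c j %% d).
    by apply: (@chainable_eq _ d) => i; apply: ltnW; rewrite ltn_mod.
  have c3 : chainable (fun i j => size (u c i) %% d = size (u c j) %% d).
    by apply: (@chainable_eq _ d) => i; apply: ltnW; rewrite ltn_mod.
  by apply: chainable_sub (chainable_and c1 (chainable_and c2 c3)) => i j _ [[? ?] [? ?]].
apply: chainable_sub (shift _ cS) => i0 j0 ij0 [dE lE rE uE].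
have ti : t <= t + i0 by exact: leq_addr.
have tj : t <= t + j0 by exact: leq_addr.
have ij : t + i0 <= t + j0 by rewrite leq_add2l ltnW.
move: (t + i0) (t + j0) ti tj ij dE lE rE uE => i j ti tj ij dE lE rE uE {i0 j0 ij0}.
have pu := sent_prefix cN ij; have su := size_prefix pu; have rr := received_mono cN ij.
have si := received_sent i cN; have sj := received_sent j cN.
have req : r c i = r c j -> len (e i) c = len (e j) c ->
    drop (r c i) (u c i) = drop (r c j) (u c j).
  move=> E; rewrite /len -/(u c i) -/(u c j) -/(r c i) -/(r c j) -E => L.
  congr drop; have sz : size (u c i) = size (u c j) by rewrite -E in sj; lia.
  case/prefixP: pu => s Es; move: sz; rewrite Es size_cat.
  by case: s Es => [|a s] _ /=; [rewrite cats0|lia].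
case: D => [C|P].
  have E : r c i = r c j by rewrite !C.
  by split=> //; [apply/orP; left; apply/eqP|exact: req].
have dr : d %| r c j - r c i by rewrite -eqn_mod_dvd // rE.
have du : d %| size (u c j) - size (u c i) by rewrite -eqn_mod_dvd // uE.
split=> //.
  rewrite /steady -/(r c i) -/(r c j) -/(u c i) -/(u c j).
  have [//|ne] := eqVneq (r c i) (r c j); apply/hasP; exists d.
    (* [d] divides a positive number of received letters, so it lies in the range searched by
       [steady]. *)
    rewrite mem_iota add0n ltnS; apply: leq_trans sj; apply: leq_trans (leq_subr (r c i) _).
    by apply: dvdn_leq dr; rewrite subn_gt0 ltn_neqAle ne.
  by rewrite d0 !dividesP du dr; exact: P.
(* Two factors of one periodic word with the same phase and length coincide. *)
move=> L; apply: (@eq_from_nth _ 0); first by rewrite !size_drop.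
move=> k; rewrite size_drop => hk; rewrite !nth_drop (prefix_nth pu); last by rewrite -ltn_subRL.
have kj : r c j + k < size (u c j) by rewrite -ltn_subRL; move: L; rewrite /len => <-.
have ki : r c i + k < size (u c j) by apply: leq_ltn_trans kj; rewrite leq_add2r.
rewrite (periodic_from_mod d0 (P i j ti) (leq_addr _ _) ki).
rewrite (periodic_from_mod d0 (P i j ti) (leq_trans rr (leq_addr _ _)) kj).
congr nth; congr addn; rewrite addKn -addnBAC //.
by case/dvdnP: dr => q ->; rewrite modnMDl.
Qed.

Hypothesis q_bound : forall i, (e i).1 <= nstates M.
Hypothesis keys_distinct : forall i j, i < j -> key I (e i) <> key I (e j).

Lemma pump_exists : exists i j, i < j /\ pump I (e i) (e j).
Proof.
have [|t Ht] := @bounded_witnesses _ (iota 0 N) settled.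
  by move=> c; rewrite mem_iota => cN; exact: settles.
have cR : chainable (fun i j => forall c, c < N -> repeats c (t + i) (t + j)).
  apply: chainable_all => c cN; apply: chainable_repeats => //.
  have [|t' tt'] := Ht c; first by rewrite mem_iota.
  exact: settled_later.
have cq := @chainable_eq (fun i => (e (t + i)).1) _ (fun i => q_bound _).
have [//|phi ip H] := chainable_and cq cR (psi := id).
have p01 := ip 0 1 isT; have [qE R] := H 0 1 isT.
exists (t + phi 0), (t + phi 1); split; first by rewrite ltn_add2l.
apply/and3P; split; first exact/eqP.
  apply/allP => c; rewrite mem_iota => cN; have [d1 d2 d3 _] := R _ cN.
  by apply/and3P; split=> //; exact/eqP.
(* If no channel grew, all lengths would agree, hence all contents, and the two keys would be
   equal. *)
apply/negPn/negP => no; apply: (@keys_distinct (t + phi 0) (t + phi 1)); first by rewrite ltn_add2l.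
rewrite /key qE; congr pair; apply/eq_in_map => c cI.
have cN : c < N by move: cI; rewrite mem_iota.
have [d1 d2 _ d4] := R _ cN; congr pair => //; apply: d4.
apply/eqP; rewrite eqn_leq d2 leqNgt; apply/negP => lt.
by case/negP: no; apply/hasP; exists c.
Qed.

End Completeness.

(** The heads of the nested traces given by [koenig] form an infinite run with distinct keys, and
    trace [j] contains all its earlier histories. *)
Lemma infinite_pumpable (M : fifo) (As : seq nfa) :
  instance_wf M As -> instance_promise M As ->
  (forall n, level (M, As) n <> [::]) ->
  exists n, has (fun tr => pumpable (M, As) tr) (level (M, As) n).
Proof.
move=> wfM prM ne; have [t [t0 T]] := infinite_trace wfM ne.
pose e n := head (start (M, As)) (t n).
have tS n : t n.+1 = e n.+1 :: t n by have [_ [x E]] := T n; rewrite /e E.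
have mem i j : i <= j -> e i \in t j.
  move=> /subnK <-; elim: (j - i) => [|k IH]; last by rewrite addSn tS inE IH orbT.
  by case: i => [|i]; rewrite add0n ?tS ?inE ?eqxx // /e t0 inE.
have lv n : t n \in level (M, As) n by case: (T n).
have e_start i : steps M As (start (M, As)) (e i).
  by case: (level_steps wfM (lv i) (mem i i (leqnn i))).
have e_steps i j : i <= j -> steps M As (e i) (e j).
  by move=> ij; case: (level_steps wfM (lv j) (mem i j ij)).
have keys i j : i < j -> key (M, As) (e i) <> key (M, As) (e j).
  case: j => // j; rewrite ltnS => ij E.
  have /(levelS wfM)[tr0 [x [Ex _ _]]] := lv j.+1.
  by move: Ex; rewrite tS => -[<- <-]; rewrite -E map_f // mem.
have qb i : (e i).1 <= nstates M.
  elim: (e_start i) => [|x y _ IH m]; first by case: wfM => -[/ltnW].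
  by case: m => c a q' /(delta_wf wfM)[_ /ltnW].
have [i [j [ij P]]] := pump_exists wfM prM e_start e_steps qb keys.
exists j; apply/hasP; exists (t j) => //; apply/hasP; exists (e i) => //.
by apply: mem; exact: ltnW.
Qed.

Theorem theorem5p6 :
  exists P : cm_prog,
    forall (M : fifo) (As : seq nfa),
      instance_wf M As -> instance_promise M As ->
      exists b : bool,
        cm_computes P (enc_instance M As) (nat_of_bool b) /\
        (b = true <-> Reach_infinite M As).
Proof.
have [g g_cmp gE] := PR_answer.
have [P HP] := cmp_search g_cmp.
exists P => M As wfM prM.
have E n : g (cpair (enc_instance M As) n) = answer (M, As) n by rewrite (gE ((M, As), n)).
have [n0 hn0] : exists n, answer (M, As) n != 0.
  have [ne|] := classic (forall n, level (M, As) n <> [::]).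
    have [n hn] := infinite_pumpable wfM prM ne; exists n.
    by rewrite /answer hn; case: ifP.
  move=> /not_all_ex_not[n /NNPP hn]; exists n; by rewrite /answer hn.
have ex : exists n, answer (M, As) n != 0 by exists n0.
(* The search stops at the least conclusive depth, where [answer] is 1 or 2, and returns its
   predecessor. *)
case: (ex_minnP ex) => n hn min.
exists (answer (M, As) n == 2); split.
  apply: (HP _ n).
    move=> m mn; rewrite E; apply/eqP; apply/negPn/negP => /min; by rewrite leqNgt mn.
  by rewrite E; move: hn; rewrite /answer; case: ifP => // _; case: ifP.
move: hn; rewrite /answer; case: ifP => [/nilP nl _|_].
  by split=> // inf; case: (level_nil_finite wfM prM nl inf).
case: ifP => // /hasP[tr h p] _; split=> // _.
exact: (pumpable_infinite wfM prM h p).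
Qed.
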